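(* Let $(H_n)_{n\in\mathbb N}$ be a sequence of Hilbert spaces, let $\boldsymbol y=(y_n)_{n\in\mathbb N}\in\times_{n\in\mathbb N}H_n$ be a $C_0$-sequence, and let $A_n\in\mathcal L(H_n)$ for all $n\in\mathbb N$. Then the following are equivalent: (a) $\bigotimes_{n\in\mathbb N}^{\boldsymbol y}A_n$ is well-defined (in the factorwise sense) and nonzero. (b) $\widehat\bigotimes_{n\in\mathbb N}^{\boldsymbol y}A_n$ is well-defined (in the strong-limit sense) and nonzero. (c) The following conditions hold: (i) $A_n\ne0$ for all $n\in\mathbb N$; (ii) $\prod_{n\in\mathbb N}\max\{1,\|A_n\|\}<\infty$; and (iii) $\sum_{n\in\mathbb N}|1-\langle A_ny_n,y_n\rangle|<\infty$. If these conditions hold, then the complete tensor product $\bigotimes_{n\in\mathbb N}A_n$ is well-defined as a bounded operator on $\bigotimes_{n\in\mathbb N}H_n$, it leaves $\bigotimes_{n\in\mathbb N}^{\boldsymbol y}H_n$ invariant, $$\bigotimes_{n\in\mathbb N}^{\boldsymbol y}A_n=\widehat\bigotimes_{n\in\mathbb N}^{\boldsymbol y}A_n=\Bigl(\bigotimes_{n\in\mathbb N}A_n\Bigr)\Big|_{\bigotimes_{n\in\mathbb N}^{\boldsymbol y}H_n},$$ and $$\Bigl\|\bigotimes_{n\in\mathbb N}^{\boldsymbol y}A_n\Bigr\|=\Bigl\|\widehat\bigotimes_{n\in\mathbb N}^{\boldsymbol y}A_n\Bigr\|=\prod_{n\in\mathbb N}\|A_n\|.$$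
   Context: Hilbert spaces are complex; $\mathcal L(H)$ denotes the bounded operators on $H$. Products: for $(z_n)\subset\mathbb C$, $\prod_nz_n$ converges unconditionally to $a\in\mathbb C$ if $\lim_{N\to\infty}\prod_{n=1}^Nz_{\sigma(n)}=a$ for every bijection $\sigma:\mathbb N\to\mathbb N$ (equivalently, the net of products over finite subsets of $\mathbb N$, ordered by inclusion, converges to $a$). Infinite products are understood unconditionally. $\prod_nz_n$ is quasi-convergent if $\prod_n|z_n|$ converges unconditionally to a finite value; its value is then the unconditional limit of $\prod_nz_n$ if it exists and $0$ otherwise. Tensor products of spaces: $(h_n)\in\times_nH_n$ is a $C$-sequence if $\prod_n\|h_n\|$ converges unconditionally to a finite value. For a $C$-sequence $(h_n)$ the elementary tensor $\bigotimes_nh_n$ is the functional $(f_n)\mapsto\prod_n\langle h_n,f_n\rangle$ (quasi-convergent product) on the set of $C$-sequences. The complete tensor product $\bigotimes_nH_n$ is the completion of the linear span of elementary tensors with inner product determined by $\langle\bigotimes_nh_n,\bigotimes_nf_n\rangle=\prod_n\langle h_n,f_n\rangle$. A $C$-sequence is a $C_0$-sequence if $\sum_n|1-\|h_n\||<\infty$; two $C_0$-sequences $(h_n),(f_n)$ are equivalent if $\sum_n|1-\langle h_n,f_n\rangle|<\infty$ (an equivalence relation). For a $C_0$-sequence $\boldsymbol y$, the incomplete tensor product $\bigotimes_n^{\boldsymbol y}H_n$ is the closed linear span in $\bigotimes_nH_n$ of the $\bigotimes_nh_n$ with $(h_n)$ a $C_0$-sequence equivalent to $\boldsymbol y$. Tensor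 products of operators $A_n\in\mathcal L(H_n)$: The complete tensor product $\bigotimes_nA_n$ is well-defined if for every elementary tensor $\bigotimes_nh_n$ in $\bigotimes_nH_n$ also $\bigotimes_nA_nh_n$ is an elementary tensor, and $\bigotimes_nh_n\mapsto\bigotimes_nA_nh_n$ extends linearly to a bounded operator on $\bigotimes_nH_n$ (denoted $\bigotimes_nA_n$). The incomplete tensor product $\bigotimes_n^{\boldsymbol y}A_n$ is well-defined in the factorwise sense if for every elementary tensor $\bigotimes_nh_n\in\bigotimes_n^{\boldsymbol y}H_n$, $\bigotimes_nA_nh_n$ is an elementary tensor in $\bigotimes_n^{\boldsymbol y}H_n$, and $\bigotimes_nh_n\mapsto\bigotimes_nA_nh_n$ extends linearly to a bounded operator on $\bigotimes_n^{\boldsymbol y}H_n$ (denoted $\bigotimes_n^{\boldsymbol y}A_n$). For finite $F\subset\mathbb N$ let $A_F^{(\boldsymbol y)}\in\mathcal L(\bigotimes_n^{\boldsymbol y}H_n)$ be $(\bigotimes_{n\in F}A_n)\otimes I$ under the canonical unitary identification $\bigotimes_n^{\boldsymbol y}H_n\simeq(\bigotimes_{n\in F}H_n)\otimes(\bigotimes_{n\notin F}^{(y_n)_{n\notin F}}H_n)$, i.e. $A_n$ acts on the factors $n\in F$ and the identity on the others. $\widehat\bigotimes_n^{\boldsymbol y}A_n$ is well-defined in the strong-limit sense if the net $(A_F^{(\boldsymbol y)})_F$, indexed by finite subsets $F\subset\mathbb N$ ordered by inclusion, converges strongly to a bounded operator, which is denoted $\widehat\bigotimes_n^{\boldsymbol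 y}A_n$. *)

(* Defs.v *)
From HB Require Import structures.
From mathcomp Require Import all_boot all_order all_algebra finmap.
From mathcomp Require Import all_classical all_reals all_analysis.
From mathcomp Require Export summability.
From mathcomp Require Export complex sesquilinear.

Set Implicit Arguments.
Unset Strict Implicit.
Unset Printing Implicit Defensive.

Import Order.TTheory GRing.Theory Num.Theory.
Import numFieldNormedType.Exports.

Local Open Scope classical_set_scope.
Local Open Scope complex_scope.
Local Open Scope ring_scope.

(* Complex Hilbert spaces: the scalar field is R[i] for R : realType.
   [inner] is linear in its first and conjugate-linear in its second argument;
   norms of vectors are elements of R[i] (real and nonnegative). *)
HB.mixin Record isHilbert (R : realType) V of CompleteNormedModule R[i] V := {
  inner : {dot V for (@Num.conj R[i])};
  inner_normE : forall x : V, inner x x = `|x| ^+ 2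
}.

#[short(type="hilbertType")]
HB.structure Definition Hilbert (R : realType) :=
  {V of isHilbert R V & CompleteNormedModule R[i] V}.

(* K^o is K with the topology given by its norm. *)
Definition uncond_prod (K : numFieldType) (z : nat -> K) (a : K) : Prop :=
  forall s : nat -> nat, bijective s ->
    ((\prod_(n < N) z (s n) : K^o) @[N --> \oo] --> (a : K^o)).

(* Value of a quasi-convergent product: the unconditional limit if there is
   one, and 0 otherwise. *)
Definition qprod (R : realType) (z : nat -> R[i]) : R[i] :=
  xget 0 [set a | uncond_prod z a].

Definition abs_summable (R : realType) (z : nat -> R[i]) : Prop :=
  (\sum_(0 <= n <oo) (complex.Re `|z n|)%:E < +oo)%E.

Definition lin_span (K : pzRingType) (V : lmodType K) (S : set V) : set V :=
  [set x | exists (m : nat) (a : 'I_m -> K) (v : 'I_m -> V),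
     (forall i, S (v i)) /\ x = \sum_i a i *: v i].

(* Bounded operators on a linear subspace W of V are represented by functions
   V -> V whose values outside W are irrelevant. *)
Section operators.
Context {R : realType} {V : hilbertType R}.
Implicit Types (W : set V) (B : V -> V).

Definition bounded_op_on W B : Prop :=
  [/\ forall x, W x -> W (B x),
      forall (a : R[i]) x x', W x -> W x' -> B (a *: x + x') = a *: B x + B x'
    & exists M : R[i], forall x, W x -> `|B x| <= M * `|x|].

Definition nonzero_on W B : Prop := exists2 x, W x & B x != 0.

Definition opnorm W B : R :=
  sup [set complex.Re `|B x| | x in [set x | W x /\ `|x| <= 1]].

End operators.

Section tensor.
Context {R : realType} (H : nat -> hilbertType R).

Definition is_Cseq (h : forall n, H n) : Prop :=
  exists a : R[i], uncond_prod (fun n => `|h n|) a.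

Definition Cseq : Type := {h : forall n, H n | is_Cseq h}.

Definition is_C0seq (h : forall n, H n) : Prop :=
  abs_summable (fun n => 1 - `|h n|).

Definition C0_equiv (h f : forall n, H n) : Prop :=
  abs_summable (fun n => 1 - inner (h n) (f n)).

(* For C-sequences h and f the product of the <h_n, f_n> is quasi-convergent,
   so [elem_tensor h] is only meaningful when h is a C-sequence. *)
Definition elem_tensor (h : forall n, H n) : Cseq -> R[i]^o :=
  fun f => qprod (fun n => inner (h n) (sval f n)).

Definition elem_tensor_span : set (Cseq -> R[i]^o) :=
  lin_span [set elem_tensor h | h in is_Cseq].

(* A completion of the span of the elementary tensors: a Hilbert space with a
   linear isometry from the span onto a dense subspace; it is determined up to
   a unique unitary compatible with [ct_emb].  The values of [ct_emb] outside
   the span are irrelevant. *)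
Record complete_tensor := CompleteTensor {
  ct_space :> hilbertType R;
  ct_emb : (Cseq -> R[i]^o) -> ct_space;
  ct_linear : forall (a : R[i]) Phi Psi,
    elem_tensor_span Phi -> elem_tensor_span Psi ->
    ct_emb (a *: Phi + Psi) = a *: ct_emb Phi + ct_emb Psi;
  ct_inner : forall h f, is_Cseq h -> is_Cseq f ->
    inner (ct_emb (elem_tensor h)) (ct_emb (elem_tensor f)) =
      qprod (fun n => inner (h n) (f n));
  ct_dense : closure (ct_emb @` elem_tensor_span) = setT
}.

Variable T : complete_tensor.

Definition tens (h : forall n, H n) : T := ct_emb T (elem_tensor h).

Definition incomplete_tensor (y : forall n, H n) : set T :=
  closure (lin_span [set tens h | h in [set h | is_C0seq h /\ C0_equiv h y]]).

Variable A : forall n, {linear H n -> H n}.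

Definition app_seq (h : forall n, H n) : forall n, H n := fun n => A n (h n).

Definition app_seq_on (F : {fset nat}) (h : forall n, H n) : forall n, H n :=
  fun n => if n \in F then A n (h n) else h n.

(* B is the operator (x)_n A_n on the complete tensor product. *)
Definition complete_tensor_op (B : T -> T) : Prop :=
  bounded_op_on setT B /\
  forall h, is_Cseq h -> is_Cseq (app_seq h) /\ B (tens h) = tens (app_seq h).

Variable y : forall n, H n.

(* B is the operator (x)_n^y A_n, in the factorwise sense. *)
Definition factorwise_tensor_op (B : T -> T) : Prop :=
  bounded_op_on (incomplete_tensor y) B /\
  forall h, is_Cseq h -> incomplete_tensor y (tens h) ->
    [/\ is_Cseq (app_seq h), incomplete_tensor y (tens (app_seq h))
      & B (tens h) = tens (app_seq h)].

(* B is the operator A_F^(y): A_n on the factors n in F, I on the others. *)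
Definition partial_tensor_op (F : {fset nat}) (B : T -> T) : Prop :=
  bounded_op_on (incomplete_tensor y) B /\
  forall h, is_C0seq h -> C0_equiv h y ->
    B (tens h) = tens (app_seq_on F h).

(* B is the strong limit of the net A_F^(y). *)
Definition strong_limit_tensor_op (B : T -> T) : Prop :=
  bounded_op_on (incomplete_tensor y) B /\
  exists AF : {fset nat} -> T -> T,
    (forall F, partial_tensor_op F (AF F)) /\
    (forall x, incomplete_tensor y x -> AF F x @[F --> totally] --> B x).

End tensor.

Arguments tens {R H} T h.
Arguments incomplete_tensor {R H} T y.
Arguments complete_tensor_op {R H} T A B.
Arguments factorwise_tensor_op {R H} T A y B.
Arguments partial_tensor_op {R H} T A y F B.
Arguments strong_limit_tensor_op {R H} T A y B.

(* Main.v *)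
Require Import Defs.
From HB Require Import structures.
From mathcomp Require Import all_boot all_order all_algebra finmap.
From mathcomp Require Import all_classical all_reals all_analysis.
From mathcomp Require Import spectral ring lra.

Set Implicit Arguments.
Unset Strict Implicit.
Unset Printing Implicit Defensive.

Import Order.TTheory GRing.Theory Num.Theory.
Import numFieldNormedType.Exports.

Local Open Scope classical_set_scope.
Local Open Scope ring_scope.

(* Only near-one sequences matter: a C-sequence h either has
   prod |h_n| = 0, and then (x) h_n = 0, or it is a C0-sequence with nonzero
   entries.  If c_n >= |A_n|^2 and sum |1 - c_n| < oo, the form
   q_n(u, v) = c_n <u, v> - <A_n u, A_n v> is positive, and Cauchy-Schwarz for
   q_n shows that A transports C0-sequences and their equivalence.  By the Schur
   product theorem the Gram matrices of elementary tensors satisfy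
   (<(x) A h_i, (x) A h_j>) <= (prod c_n) (<(x) h_i, (x) h_j>), which yields the
   operator on the complete tensor product and, by density, everything that
   follows from (c).  Conversely a nonzero (x)^y A_n has an elementary tensor
   (x) h_n with nonzero image; hence A h ~ y ~ h, and changing finitely many
   entries of h bounds prod_{n in F} |A_n| by a multiple of the operator norm.
   For the strong limit, convergence of <A_F (x) h_n, (x) g_n> to a nonzero
   number forces sum |1 - <A_n h_n, g_n>| < oo, because unconditional
   convergence of a complex product to a nonzero limit is absolute. *)

(** Unconditional convergence quantifies over rearrangements, while every estimate runs over finite
    sets. The two viewpoints agree as soon as the limit is nonzero, but this is not formal: sets
    with bad products have to be threaded into a single rearrangement. Quasi-values raise a second
    obstacle: a divergent product of inner products counts as 0, so Gram matrices of elementary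
    tensors are not entrywise limits of finite products. The bound [c n] is chosen in three ways.
    Condition (ii) controls only [max(1, |A_n|)^2], and this choice serves to transport sequences.
    Once [A y] is known to be a C0-sequence, [|A_n|] itself is near 1, and [c n = |A_n|^2] gives the
    sharp constant [prod |A_n|]. For the partial operators [A_F], [c] is replaced by 1 outside [F],
    so that they are complete tensor products as well. *)

Section rnorm.
Context {R : realType}.
Implicit Types (V : normedModType R[i]) (z w : R[i]) (r : R).

(** Norms take values in [R[i]]; their real parts live in an ordered field where [lra] and [nra]
    apply. *)
Definition rnorm (V : normedZmodType R[i]) (x : V) : R := complex.Re `|x|.

Lemma rnormE (V : normedZmodType R[i]) (x : V) : `|x| = (rnorm x)%:C%C.
Proof. by rewrite RRe_real ?normr_real. Qed.

Lemma rnorm_ge0 (V : normedZmodType R[i]) (x : V) : 0 <= rnorm x.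
Proof. by rewrite -ler0c -rnormE normr_ge0. Qed.

Lemma rnorm0 (V : normedZmodType R[i]) : rnorm (0 : V) = 0.
Proof. by rewrite /rnorm normr0. Qed.

Lemma rnorm_eq0 (V : normedZmodType R[i]) (x : V) : (rnorm x == 0) = (x == 0).
Proof.
rewrite -(normr_eq0 x) rnormE; apply/eqP/eqP => [->//|].
by move=> [].
Qed.

Lemma rnorm_gt0 (V : normedZmodType R[i]) (x : V) : (0 < rnorm x) = (x != 0).
Proof. by rewrite lt_def rnorm_ge0 andbT rnorm_eq0. Qed.

Lemma rnormD (V : normedZmodType R[i]) (x y : V) :
  rnorm (x + y) <= rnorm x + rnorm y.
Proof. by rewrite -lecR rmorphD /= -!rnormE ler_normD. Qed.

Lemma rnormN (V : normedZmodType R[i]) (x : V) : rnorm (- x) = rnorm x.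
Proof. by rewrite /rnorm normrN. Qed.

Lemma rnormB (V : normedZmodType R[i]) (x y : V) :
  rnorm (x - y) <= rnorm x + rnorm y.
Proof. by rewrite (le_trans (rnormD _ _)) // rnormN. Qed.

Lemma rdistC (V : normedZmodType R[i]) (x y : V) : rnorm (x - y) = rnorm (y - x).
Proof. by rewrite /rnorm distrC. Qed.

Lemma rdistD (V : normedZmodType R[i]) (z x y : V) :
  rnorm (x - y) <= rnorm (x - z) + rnorm (z - y).
Proof. by rewrite (le_trans _ (rnormD _ _)) // addrA subrK. Qed.

Lemma rnorm_sub_le (V : normedZmodType R[i]) (x y : V) :
  rnorm x - rnorm y <= rnorm (x - y).
Proof. by rewrite lerBlDr -{1}(subrK y x) rnormD. Qed.

Lemma rnorm1 : rnorm (1 : R[i]) = 1.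
Proof. by rewrite /rnorm normr1. Qed.

Lemma rnormM z w : rnorm (z * w) = rnorm z * rnorm w.
Proof. by rewrite /rnorm normrM !rnormE -rmorphM. Qed.

Lemma rnormX z n : rnorm (z ^+ n) = rnorm z ^+ n.
Proof. by rewrite /rnorm normrX rnormE -rmorphXn. Qed.

Lemma rnormZ V z (x : V) : rnorm (z *: x) = rnorm z * rnorm x.
Proof. by rewrite /rnorm normrZ !rnormE -rmorphM. Qed.

Lemma rnorm_prod I (s : seq I) (P : pred I) (F : I -> R[i]) :
  rnorm (\prod_(i <- s | P i) F i) = \prod_(i <- s | P i) rnorm (F i).
Proof. by elim/big_rec2: _ => [|i a b _ <-]; rewrite ?rnorm1 ?rnormM. Qed.

Lemma rnormR r : rnorm (r%:C%C : R[i]) = `|r|.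
Proof. by rewrite /rnorm normc_def /= expr0n addr0 sqrtr_sqr. Qed.

Lemma rnormJ z : rnorm z^* = rnorm z.
Proof. by rewrite /rnorm norm_conjC. Qed.

Lemma rnorm_Re z : `|complex.Re z| <= rnorm z.
Proof. by rewrite -lecR -rnormE normc_ge_Re. Qed.

Lemma rnorm_Im z : `|complex.Im z| <= rnorm z.
Proof.
have := rnorm_Re (z * 'i%C); rewrite ReiNIm normrN.
have -> : rnorm (z * 'i%C) = rnorm z; last by [].
rewrite rnormM; have -> : rnorm ('i%C : R[i]) = 1; last by rewrite mulr1.
by rewrite /rnorm normc_def /= expr0n add0r expr1n sqrtr1.
Qed.

Lemma rnorm_ReIm z : rnorm z <= `|complex.Re z| + `|complex.Im z|.
Proof.
rewrite [z in leLHS]complexE (le_trans (rnormD _ _)) // rnormM !rnormR.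
have -> : rnorm ('i%C : R[i]) = 1; last by rewrite mul1r.
by rewrite /rnorm normc_def /= expr0n add0r expr1n sqrtr1.
Qed.

Lemma ReD z w : complex.Re (z + w) = complex.Re z + complex.Re w.
Proof. by case: z w => [? ?] []. Qed.

Lemma ReN z : complex.Re (- z) = - complex.Re z.
Proof. by case: z. Qed.

Lemma ReB z w : complex.Re (z - w) = complex.Re z - complex.Re w.
Proof. by rewrite ReD ReN. Qed.

Lemma ReRM r z : complex.Re (r%:C%C * z) = r * complex.Re z.
Proof. by case: z => a b /=; rewrite mul0r subr0. Qed.

Lemma cvg_rnormP V T (F : set_system T) {FF : Filter F} (f : T -> V) (l : V) :
  f @ F --> l <-> forall e : R, 0 < e -> \forall t \near F, rnorm (f t - l) < e.
Proof.
split=> [/cvgrPdist_lt fl e e0|fl].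
  have /fl : 0 < e%:C%C by rewrite ltcR.
  by apply: filterS => t; rewrite rdistC -ltcR -rnormE.
apply/(cvgrPdist_lt (FF := FF)) => e e0.
have eE : e = (complex.Re e)%:C%C by rewrite RRe_real ?gtr0_real.
rewrite eE ltcR in e0; apply: filterS (fl _ e0) => t.
by rewrite rdistC -ltcR -rnormE -eE.
Qed.

Lemma closure_rnormP V (S : set V) (x : V) :
  closure S x <-> forall e : R, 0 < e -> exists2 y, S y & rnorm (x - y) < e.
Proof.
split=> [xS e e0|xS].
  have : nbhs x [set y | rnorm (x - y) < e].
    have /cvg_rnormP/(_ e e0) h : (fun y : V => y) @ x --> x by exact: cvg_id.
    by apply: filterS h => y; rewrite rdistC.
  by move=> /xS [y [Sy /= xy]]; exists y.
move=> B /nbhs_normP [e /= e0 eB].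
have eE : e = (complex.Re e)%:C%C by rewrite RRe_real ?gtr0_real.
rewrite eE ltcR in e0; have [y Sy xy] := xS _ e0.
exists y; split=> //; apply: eB; rewrite /= /ball_ /=.
by rewrite rnormE eE ltcR.
Qed.

Lemma cvg_rnorm_bnd V T (F : set_system T) {FF : ProperFilter F} (f : T -> V)
  (l : V) (M : R) :
  f @ F --> l -> (\forall t \near F, rnorm (f t) <= M) -> rnorm l <= M.
Proof.
move=> /cvg_rnormP fl fM; apply/ler_addgt0Pr => e e0.
have [t [/= tl tM]] := @filter_ex _ F _ _ (filterI (fl e e0) fM).
have := rnorm_sub_le l (f t); rewrite rdistC; lra.
Qed.

End rnorm.

(** * Inner products, phases and the Cauchy-Schwarz inequality *)

Section hilbert.
Context {R : realType} {V : hilbertType R}.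
Implicit Types (u v w : V).

Lemma inner_rnorm u : inner u u = ((rnorm u) ^+ 2)%:C%C.
Proof. by rewrite inner_normE rnormE rmorphXn. Qed.

Lemma innerC u v : inner u v = (inner v u)^*.
Proof. by have := hermC (@inner R V) u v; rewrite expr0 mul1r. Qed.

Lemma innerDl u v w : inner (u + v) w = inner u w + inner v w.
Proof. exact: linearDl. Qed.
Lemma innerDr u v w : inner u (v + w) = inner u v + inner u w.
Proof. exact: linearDr. Qed.
Lemma innerNl u w : inner (- u) w = - inner u w.
Proof. exact: linearNl. Qed.
Lemma innerNr u w : inner u (- w) = - inner u w.
Proof. exact: linearNr. Qed.
Lemma innerZl a u w : inner (a *: u) w = a * inner u w.
Proof. exact: linearZl_LR. Qed.
Lemma innerZr a u w : inner u (a *: w) = a^* * inner u w.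
Proof. exact: linearZr_LR. Qed.
Lemma inner0l u : inner 0 u = 0.
Proof. exact: linear0l. Qed.
Lemma inner0r u : inner u 0 = 0.
Proof. exact: linear0r. Qed.
Lemma innerBl u v w : inner (u - v) w = inner u w - inner v w.
Proof. by rewrite innerDl innerNl. Qed.
Lemma innerBr u v w : inner u (v - w) = inner u v - inner u w.
Proof. by rewrite innerDr innerNr. Qed.

Lemma ReJ (z : R[i]) : complex.Re z^* = complex.Re z.
Proof. by case: z. Qed.

Lemma rnormB2 u v :
  rnorm (u - v) ^+ 2 = rnorm u ^+ 2 + rnorm v ^+ 2 - 2 * complex.Re (inner u v).
Proof.
have := inner_rnorm (u - v).
rewrite innerBl !innerBr !inner_rnorm (innerC v u).
by move=> /(congr1 (@complex.Re R)) /=; rewrite !(ReB, ReJ) /= => <-; ring.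
Qed.

Lemma rnormD2 u v :
  rnorm (u + v) ^+ 2 = rnorm u ^+ 2 + rnorm v ^+ 2 + 2 * complex.Re (inner u v).
Proof. by rewrite -[v in LHS]opprK rnormB2 rnormN innerNr ReN; ring. Qed.

End hilbert.

(** The witness is [z / |z|]. It is conjugated because phases enter through the second,
    conjugate-linear slot of [inner]. *)
Lemma unit_phase {R : realType} (z : R[i]) :
  exists2 w : R[i], rnorm w = 1 & complex.Re (w^* * z) = rnorm z.
Proof.
have [->|z0] := eqVneq z 0.
  by exists 1; rewrite ?rnorm1 // mulr0 rnorm0.
have nz : rnorm z != 0 by rewrite rnorm_eq0.
exists (z * ((rnorm z)^-1)%:C%C).
  by rewrite rnormM rnormR ger0_norm ?invr_ge0 ?rnorm_ge0 // mulfV.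
have J : Num.conj ((rnorm z)^-1)%:C%C = ((rnorm z)^-1)%:C%C :> R[i].
  exact: conjc_real.
rewrite rmorphM /= J mulrC mulrA -normCK rnormE -rmorphXn -rmorphM /=.
by rewrite expr2 mulfK.
Qed.

Section forms.
Context {R : realType} {V W : hilbertType R}.

(* Positivity of the form q(u, v) = c <u, v> - <A u, A v> at u - w v, where the
   phase w makes Re (w^* q(u, v)) = |q(u, v)|. *)
Lemma defect_form_le (A : {linear V -> W}) (c : R) (u v : V) :
  (forall u, rnorm (A u) ^+ 2 <= c * rnorm u ^+ 2) ->
  rnorm (c%:C%C * inner u v - inner (A u) (A v)) <=
  ((c * rnorm u ^+ 2 - rnorm (A u) ^+ 2) +
   (c * rnorm v ^+ 2 - rnorm (A v) ^+ 2)) / 2.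
Proof.
move=> Ac; set q := _ - inner _ _.
have [w w1 wq] := unit_phase q.
have := Ac (u - w *: v).
rewrite linearB linearZ /= !rnormB2 !rnormZ w1 !innerZr !mul1r.
move: wq; rewrite /q mulrBr ReB mulrCA ReRM => <-.
lra.
Qed.

End forms.

(** Positivity of [|a - w b|^2] bounds [|<a, b>|] by the mean of [|a|^2] and [|b|^2]. The rescaled
    vectors [|v| u] and [|u| v] have equal norms, and for them the mean is the product of the
    norms. *)
Lemma inner_CauchySchwarz {R : realType} {V : hilbertType R} (u v : V) :
  rnorm (inner u v) <= rnorm u * rnorm v.
Proof.
have [->|u0] := eqVneq u 0; first by rewrite inner0l !rnorm0 mul0r.
have [->|v0] := eqVneq v 0; first by rewrite inner0r !rnorm0 mulr0.
have nu : 0 < rnorm u by rewrite rnorm_gt0.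
have nv : 0 < rnorm v by rewrite rnorm_gt0.
have key (a b : V) : rnorm (inner a b) <= (rnorm a ^+ 2 + rnorm b ^+ 2) / 2.
  have [w w1 wq] := unit_phase (inner a b).
  have := sqr_ge0 (rnorm (a - w *: b)).
  rewrite rnormB2 innerZr rnormZ w1 mul1r wq; lra.
have := key ((rnorm v)%:C%C *: u) ((rnorm u)%:C%C *: v).
rewrite innerZl innerZr !rnormZ !rnormM rnormJ !rnormR !ger0_norm ?rnorm_ge0 //.
have : 0 < rnorm u * rnorm v by exact: mulr_gt0.
move: (rnorm u) (rnorm v) (rnorm (inner u v)) => a b x ab.
rewrite -(ler_pM2l ab x); lra.
Qed.
#[local] Existing Instance totally_filter.


(** * Unconditional sums and products *)

Section cauchy.
Context {R : realType}.

Lemma real_cauchy T (F : set_system T) {FF : ProperFilter F} (f : T -> R) :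
  (forall e, 0 < e -> exists c, \forall t \near F, `|f t - c| < e) ->
  exists l, forall e, 0 < e -> \forall t \near F, `|f t - l| < e.
Proof.
move=> cf; suff /cvg_ex[l /cvgrPdist_lt fl] : cvg (f @ F).
  exists l => e e0; apply: filterS (fl e e0) => t /=.
  by rewrite distrC.
apply: cauchy_cvg; apply: cauchy_exP => e e0.
have [c fc] := cf e e0; exists c.
by apply: filterS fc => t; rewrite /ball /= distrC.
Qed.

(** Completeness of [R[i]] is reduced to that of [R] through real and imaginary parts. *)
Lemma complex_cauchy T (F : set_system T) {FF : ProperFilter F} (f : T -> R[i]) :
  (forall e : R, 0 < e -> exists c, \forall t \near F, rnorm (f t - c) < e) ->
  exists l : R[i], (f : T -> R[i]^o) @ F --> (l : R[i]^o).
Proof.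
move=> cf.
have [e e0|a fa] := @real_cauchy _ F FF (fun t => complex.Re (f t)).
  have [c fc] := cf e e0; exists (complex.Re c); apply: filterS fc => t.
  by apply: le_lt_trans; rewrite -ReB rnorm_Re.
have ImB (x y : R[i]) : complex.Im (x - y) = complex.Im x - complex.Im y.
  by case: x y => [? ?] [].
have [e e0|b fb] := @real_cauchy _ F FF (fun t => complex.Im (f t)).
  have [c fc] := cf e e0; exists (complex.Im c); apply: filterS fc => t.
  by apply: le_lt_trans; rewrite -ImB rnorm_Im.
exists (a +i* b)%C; apply/cvg_rnormP => e e0.
have e20 : 0 < e / 2 by lra.
apply: filterS2 (fa _ e20) (fb _ e20) => t ta tb.
rewrite (le_lt_trans (rnorm_ReIm _)) // ReB ImB /=; lra.
Qed.

Lemma hilbert_cauchy (V : hilbertType R) T (F : set_system T)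
    {FF : ProperFilter F} (f : T -> V) :
  (forall e : R, 0 < e -> exists c, \forall t \near F, rnorm (f t - c) < e) ->
  exists l : V, f @ F --> l.
Proof.
move=> cf; suff /cvg_ex[l fl] : cvg (f @ F) by exists l.
apply: cauchy_cvg; apply: cauchy_exP => e e0.
have eE : e = (complex.Re e)%:C%C by rewrite RRe_real ?gtr0_real.
rewrite eE ltcR in e0 *; have [c fc] := cf _ e0; exists c.
apply: filterS fc => t tc; rewrite -ball_normE /ball_ /=.
by rewrite rnormE ltcR rdistC.
Qed.

End cauchy.

Section fsums.
Context {R : realType}.
Implicit Types (u v : nat -> R).

(** Summability when [u] is nonnegative. Nothing is asked from below, so comparison requires no
    signs. *)
Definition bsum u := exists M, forall F : {fset nat}, \sum_(n <- F) u n <= M.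

Lemma bsum_le u v : (forall n, u n <= v n) -> bsum v -> bsum u.
Proof.
by move=> uv [M vM]; exists M => F; rewrite (le_trans (ler_sum _ _) (vM F)).
Qed.

Lemma bsumD u v : bsum u -> bsum v -> bsum (fun n => u n + v n).
Proof.
by move=> [M uM] [N vN]; exists (M + N) => F; rewrite big_split lerD ?uM ?vN.
Qed.

Lemma bsumZ c u : 0 <= c -> bsum u -> bsum (fun n => c * u n).
Proof.
move=> c0 [M uM]; exists (c * M) => F.
by rewrite -mulr_sumr ler_wpM2l.
Qed.

Lemma sum_fsetDI u (F G : {fset nat}) :
  \sum_(n <- F) u n = \sum_(n <- (F `&` G)%fset) u n + \sum_(n <- (F `\` G)%fset) u n.
Proof.
rewrite (big_fsetID _ (mem G)); congr (_ + _); apply: eq_fbigl => n;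
  by rewrite !inE // andbC.
Qed.

Lemma sum_fset_sub u (F G : {fset nat}) : (forall n, 0 <= u n) ->
  (F `<=` G)%fset -> \sum_(n <- F) u n <= \sum_(n <- G) u n.
Proof.
move=> u0 FG; rewrite (sum_fsetDI u G F) (fsetIidPr FG) lerDl.
by rewrite sumr_ge0.
Qed.

Lemma bsum_le_cofin (F0 : {fset nat}) u v : (forall n, 0 <= v n) ->
  (forall n, n \notin F0 -> u n <= v n) -> bsum v -> bsum u.
Proof.
move=> v0 uv [M vM]; exists (\sum_(n <- F0) `|u n| + M) => F.
rewrite (sum_fsetDI u F F0) lerD //.
  apply: (@le_trans _ _ (\sum_(n <- (F `&` F0)%fset) `|u n|)).
    by apply: ler_sum => n _; exact: ler_norm.
  by apply: sum_fset_sub => //; exact: fsubsetIr.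
apply: le_trans (vM (F `\` F0)%fset).
rewrite big_seq_cond [leRHS]big_seq_cond.
by apply: ler_sum => n; rewrite andbT inE => /andP[/uv].
Qed.

Lemma bsum_bounded u : (forall n, 0 <= u n) -> bsum u ->
  exists2 M, 0 <= M & forall n, u n <= M.
Proof.
move=> u0 [M uM]; exists M => [|n].
  by have := uM fset0; rewrite big_seq_fset0.
by have := uM [fset n]%fset; rewrite big_seq_fset1.
Qed.

(** A finite set whose sum comes within [e] of the supremum of all finite sums leaves less than [e]
    to any set disjoint from it. *)
Lemma bsum_tail u e : (forall n, 0 <= u n) -> bsum u -> 0 < e ->
  exists F0 : {fset nat}, forall D : {fset nat}, [disjoint F0 & D]%fset ->
  \sum_(n <- D) u n < e.
Proof.
move=> u0 [M uM] e0.
pose S := [set \sum_(n <- F) u n | F in [set: {fset nat}]].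
have supS : has_sup S.
  split; first by exists (\sum_(n <- fset0) u n), fset0.
  by exists M => _ [F _ <-].
have [_ [F0 _ <-] F0e] := sup_adherent e0 supS.
exists F0 => D F0D.
have : \sum_(n <- (F0 `|` D)%fset) u n <= sup S.
  by apply: (ub_le_sup supS.2); exists (F0 `|` D)%fset.
rewrite (sum_fsetDI u _ F0) fsetIC fsetKU fsetDUl fsetDv fset0U.
have -> : (D `\` F0 = D)%fset by apply/fsetDidPl; rewrite fdisjoint_sym.
lra.
Qed.

Lemma abs_summableP (z : nat -> R[i]) :
  abs_summable z <-> bsum (fun n => rnorm (z n)).
Proof.
have z0 n : (0%R <= (rnorm (z n))%:E)%E by rewrite lee_fin rnorm_ge0.
split=> [|[M zM]].
  rewrite /abs_summable; set S := (X in (X < _)%E) => Sfin.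
  have S0 : (0 <= S)%E by apply: nneseries_ge0 => n _ _; exact: z0.
  exists (fine S) => F; rewrite -lee_fin fineK; last by rewrite ge0_fin_numE.
  rewrite -sumEFin.
  exact: (@lee_sum_fset_lim _ (fun n => (rnorm (z n))%:E) F xpredT).
rewrite /abs_summable (@le_lt_trans _ _ M%:E) ?ltry //.
apply: lime_le; first by apply: is_cvg_nneseries => n _ _; exact: z0.
apply: nearW => N; rewrite sumEFin lee_fin.
have := zM (seq_fset tt (index_iota 0 N)).
by rewrite (perm_big _ (seq_fset_perm _ _)) undup_id ?iota_uniq.
Qed.

End fsums.

Section fprods.
Context {K : comNzRingType}.
Implicit Types (z : nat -> K).

Lemma prod_fsetDI z (F G : {fset nat}) :
  \prod_(n <- F) z n =
  \prod_(n <- (F `&` G)%fset) z n * \prod_(n <- (F `\` G)%fset) z n.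
Proof.
rewrite (big_fsetID _ (mem G)); congr (_ * _); apply: eq_fbigl => n;
  by rewrite !inE // andbC.
Qed.

Lemma prod_fsub z (F G : {fset nat}) : (F `<=` G)%fset ->
  \prod_(n <- G) z n = \prod_(n <- F) z n * \prod_(n <- (G `\` F)%fset) z n.
Proof. by move=> FG; rewrite (prod_fsetDI z G F) (fsetIidPr FG). Qed.

Lemma prod_fsetU z (F D : {fset nat}) : [disjoint F & D]%fset ->
  \prod_(n <- (F `|` D)%fset) z n = \prod_(n <- F) z n * \prod_(n <- D) z n.
Proof.
move=> FD; rewrite (prod_fsub z (fsubsetUl F D)) fsetDUl fsetDv fset0U.
by have -> : (D `\` F = D)%fset by apply/fsetDidPl; rewrite fdisjoint_sym.
Qed.

Definition fimage (s : nat -> nat) N := seq_fset tt [seq s n | n <- iota 0 N].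

Lemma prod_fimage z s N : injective s ->
  \prod_(n <- fimage s N) z n = \prod_(n < N) z (s n).
Proof.
move=> si; rewrite (perm_big _ (seq_fset_perm _ _)) undup_id; last first.
  by rewrite map_inj_uniq ?iota_uniq.
by rewrite big_map -[N in iota 0 N]subn0 big_mkord.
Qed.

End fprods.

(** A finite set is covered once [N] exceeds the largest preimage of its elements. Hence a limit
    along [totally] is a limit along every rearrangement. *)
Lemma cvg_fimage s : bijective s -> fimage s N @[N --> \oo] --> totally.
Proof.
move=> [g sg gs] B [F _ FB].
exists (\max_(n <- F) g n).+1 => // N /= FN; apply: FB => /=.
apply/fsubsetP => n nF; rewrite seq_fsetE; apply/mapP; exists (g n) => //.
by rewrite mem_iota /= add0n (leq_trans _ FN) // ltnS (leq_bigmax_seq _ nF).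
Qed.

Lemma totallyP (P : {fset nat} -> Prop) :
  (\forall F \near totally, P F) <->
  exists F0 : {fset nat}, forall F : {fset nat}, (F0 `<=` F)%fset -> P F.
Proof. by split=> [[F0 _ h]|[F0 h]]; exists F0. Qed.

Lemma cvg_netP {R : realType} (V : normedModType R[i]) (f : {fset nat} -> V)
    (l : V) :
  f @ totally --> l <-> forall e : R, 0 < e -> exists F0 : {fset nat},
    forall F : {fset nat}, (F0 `<=` F)%fset -> rnorm (f F - l) < e.
Proof.
have P := @cvg_rnormP _ _ _ totally (@filter_filter _ _ totally_filter) f l.
split=> [/P fl e e0|fl]; first exact/totallyP/fl.
by apply/P => e e0; exact/totallyP/fl.
Qed.

(** * Products of sequences near 1 over the net of finite sets *)

Section net_products.
Context {R : realType}.
Implicit Types (z w : nat -> R[i]).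

Definition near1 z := bsum (fun n => rnorm (1 - z n)).

Definition netprod z (F : {fset nat}) : R[i]^o := \prod_(n <- F) z n.

Lemma cvg_complex_unique T (F : set_system T) {FF : ProperFilter F}
  (f : T -> R[i]^o) (a b : R[i]^o) : f @ F --> a -> f @ F --> b -> a = b.
Proof. by move=> fa fb; apply: (cvg_unique _ fa fb). Qed.

Lemma uncond_prod_unique z a b : uncond_prod z a -> uncond_prod z b -> a = b.
Proof.
have bid : bijective (@id nat) by exists id.
by move=> /(_ _ bid) za /(_ _ bid); exact: cvg_complex_unique.
Qed.

Lemma qprodE z a : uncond_prod z a -> qprod z = a.
Proof.
move=> za; rewrite /qprod; case: xgetP => [b _ zb|/(_ a)]; last by [].
exact: (uncond_prod_unique zb za).
Qed.

Lemma qprod_neq0 z : qprod z != 0 -> uncond_prod z (qprod z).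
Proof.
rewrite /qprod; case: xgetP => [a -> //|_]; by rewrite eqxx.
Qed.

Lemma net_uncond z a : netprod z @ totally --> (a : R[i]^o) -> uncond_prod z a.
Proof.
move=> za s sb; have := cvg_comp _ _ (cvg_fimage sb) za; apply: cvg_trans.
apply: near_eq_cvg; apply: nearW => N /=.
by rewrite /netprod (prod_fimage _ _ (bij_inj sb)).
Qed.

(** While the sum stays below 1/2, the induction hypothesis keeps the product [p] within 1 of 1, so
    [|p| <= 2], and a new factor [z k] moves [p] by at most [2 |1 - z k|]. *)
Lemma prod_near1_le z (s : seq nat) : \sum_(n <- s) rnorm (1 - z n) <= 2^-1 ->
  rnorm (\prod_(n <- s) z n - 1) <= 2 * \sum_(n <- s) rnorm (1 - z n).
Proof.
elim: s => [|k s IH]; first by rewrite !big_nil subrr rnorm0 mulr0.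
rewrite !big_cons => ks; have n0 := rnorm_ge0 (1 - z k).
have s0 : 0 <= \sum_(n <- s) rnorm (1 - z n) by apply: sumr_ge0 => *; exact: rnorm_ge0.
have {}IH := IH ltac:(lra).
set p := \prod_(n <- s) _ in IH *.
have -> : z k * p - 1 = (p - 1) - (1 - z k) * (1 + (p - 1)) by ring.
apply: le_trans (rnormB _ _) _; rewrite rnormM.
have : rnorm (1 + (p - 1)) <= 1 + 2^-1 * 2.
  rewrite (le_trans (rnormD _ _)) // rnorm1; lra.
move: (rnorm (1 + _)) (rnorm_ge0 (1 + (p - 1))) => r r0 r1.
nra.
Qed.

Lemma near1_tail z e : near1 z -> 0 < e ->
  exists F0 : {fset nat}, forall D : {fset nat}, [disjoint F0 & D]%fset ->
  rnorm (\prod_(n <- D) z n - 1) < e.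
Proof.
move=> zs e0.
have m0 : 0 < Num.min 2^-1 (e / 2) by rewrite lt_min; apply/andP; split; lra.
have [F0 F0e] := bsum_tail (fun=> rnorm_ge0 _) zs m0.
exists F0 => D /F0e; rewrite lt_min => /andP[D1 D2].
by apply: (le_lt_trans (prod_near1_le (ltW D1))); lra.
Qed.

(** [F0] bounds the products over larger sets by [2 M]; [F1] makes the relative change beyond it
    smaller than [e / (2 M + 1)]. *)
Lemma near1_cvg z : near1 z -> exists a : R[i], netprod z @ totally --> (a : R[i]^o).
Proof.
move=> zs; apply: (complex_cauchy (FF := totally_filter)) => e e0.
have [F0 F0e] := near1_tail zs ltr01.
set M := rnorm (\prod_(n <- F0) z n).
have M0 : 0 <= M by exact: rnorm_ge0.
have [F1 F1e] := near1_tail zs (divr_gt0 e0 (ltac:(lra) : 0 < 2 * M + 1)).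
pose G := (F0 `|` F1)%fset.
exists (\prod_(n <- G) z n); apply/totallyP; exists G => F GF.
rewrite /netprod (prod_fsub z GF) -[X in _ - X]mulr1 -mulrBr rnormM.
have F1F : [disjoint F1 & F `\` G]%fset.
  apply/fdisjointP => n nF1; rewrite !inE negb_and; by rewrite nF1 orbT.
have F0F : [disjoint F0 & G `\` F0]%fset.
  apply/fdisjointP => n nF1; rewrite !inE negb_and; by rewrite nF1.
have {}F1e := F1e _ F1F; have {}F0e := F0e _ F0F.
have : rnorm (\prod_(n <- G) z n) <= M * 2.
  rewrite (prod_fsub z (fsubsetUl F0 F1)) rnormM ler_wpM2l //.
  move: F0e; set p := \prod_(n <- (G `\` F0)%fset) _ => F0e.
  by rewrite -(subrK 1 p) (le_trans (rnormD _ _)) // rnorm1; lra.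
move: F1e; rewrite ltr_pdivlMr; last lra.
set x := rnorm _; set y := rnorm _.
have x0 : 0 <= x by exact: rnorm_ge0.
have y0 : 0 <= y by exact: rnorm_ge0.
nra.
Qed.

Lemma near1_net z : near1 z -> netprod z @ totally --> (qprod z : R[i]^o).
Proof.
by move=> /near1_cvg[a za]; rewrite (qprodE (net_uncond za)).
Qed.

Lemma near1_uncond z : near1 z -> uncond_prod z (qprod z).
Proof. by move=> /near1_net/net_uncond. Qed.

Lemma net_qprod z a : netprod z @ totally --> (a : R[i]^o) -> qprod z = a.
Proof. by move=> /net_uncond/qprodE. Qed.

(** Beyond [F0] the remaining factors multiply to something of norm at least 1/2, so the products
    over sets containing [F0] stay above [|p| / 2]. *)
Lemma near1_neq0 z : near1 z -> (forall n, z n != 0) -> qprod z != 0.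
Proof.
move=> zs z0; have /near1_net/cvg_netP zc := zs.
have [F0 F0e] := near1_tail zs (ltac:(lra) : 0 < (2^-1 : R)).
set p := \prod_(n <- F0) z n.
have p0 : 0 < rnorm p by rewrite rnorm_gt0 prodf_seq_neq0; apply/allP => n _; rewrite z0.
have [F1 F1q] := zc (rnorm p / 2) ltac:(lra).
have {F1q} := F1q _ (fsubsetUr F0 F1).
rewrite /netprod (prod_fsub z (fsubsetUl F0 F1)) -/p.
set D := (_ `\` _)%fset; have F0D : [disjoint F0 & D]%fset.
  apply/fdisjointP => n nF1; rewrite !inE negb_and; by rewrite nF1.
have {}F0e := F0e _ F0D; apply: contraTneq => ->.
rewrite subr0 rnormM -leNgt.
move: F0e; set q := \prod_(n <- D) _ => F0e.
have := rnorm_sub_le 1 (1 - q); rewrite subKr rnorm1 rdistC => h.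
nra.
Qed.

Lemma qprod_eq0 z n : z n = 0 -> qprod z = 0.
Proof.
move=> zn; apply: net_qprod; apply/cvg_netP => e e0.
exists [fset n]%fset => F nF; rewrite /netprod (prod_fsub z nF) big_seq_fset1 zn.
by rewrite mul0r subrr rnorm0.
Qed.

Lemma net_neq0 z a n : netprod z @ totally --> (a : R[i]^o) -> a != 0 -> z n != 0.
Proof.
move=> za; apply: contraNneq => zn.
by rewrite -(net_qprod za) (qprod_eq0 zn).
Qed.

End net_products.

Lemma cvg_cmul {R : realType} T (F : set_system T) {FF : Filter F}
    (f g : T -> R[i]^o) (a b : R[i]) :
  f @ F --> (a : R[i]^o) -> g @ F --> (b : R[i]^o) ->
  (f t * g t : R[i]^o) @[t --> F] --> (a * b : R[i]^o).
Proof. exact: (@cvgM R[i]). Qed.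

Section near1_theory.
Context {R : realType}.
Implicit Types (z w : nat -> R[i]).

Lemma near1_le z (u : nat -> R) : (forall n, rnorm (1 - z n) <= u n) ->
  bsum u -> near1 z.
Proof. exact: bsum_le. Qed.

Lemma near1_cofin (F : {fset nat}) z w : (forall n, n \notin F -> w n = z n) ->
  near1 z -> near1 w.
Proof.
move=> wz; apply: (@bsum_le_cofin _ F) => n; first exact: rnorm_ge0.
by move=> /wz ->.
Qed.

Lemma near1_const1 : near1 (fun=> 1 : R[i]).
Proof. by exists 0 => F; rewrite big1 // => n _; rewrite subrr rnorm0. Qed.

Lemma near1_bounded z : near1 z -> exists2 M, 0 <= M & forall n, rnorm (z n) <= M.
Proof.
move=> /(bsum_bounded (fun=> rnorm_ge0 _))[M M0 zM]; exists (M + 1); first lra.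
move=> n; have := rnorm_sub_le (z n) 1; rewrite rdistC rnorm1.
have := zM n; lra.
Qed.

Lemma near1M z w : near1 z -> near1 w -> near1 (fun n => z n * w n).
Proof.
move=> zs ws; have [M M0 zM] := near1_bounded zs.
apply: near1_le (bsumD zs (bsumZ M0 ws)) => n.
have -> : 1 - z n * w n = (1 - z n) + z n * (1 - w n) by ring.
rewrite (le_trans (rnormD _ _)) // lerD2l rnormM ler_wpM2r ?rnorm_ge0 //.
Qed.

Lemma rdist1R (r : R) : rnorm (1 - r%:C%C : R[i]) = `|1 - r|.
Proof. by rewrite -rnormR rmorphB. Qed.

(** The way back from squares uses [1 - r^2 = (1 - r) (1 + r)] with [1 + r >= 1]. It allows
    C0-sequences to be recognised by the inner products [<h_n, h_n>]. *)
Lemma near1_sqr (r : nat -> R) : (forall n, 0 <= r n) ->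
  near1 (fun n => (r n)%:C%C) <-> near1 (fun n => (r n ^+ 2)%:C%C).
Proof.
move=> r0; split=> rs.
  have := near1M rs rs; apply: (@near1_cofin fset0) => n _.
  by rewrite -rmorphM expr2.
apply: near1_le rs => n; rewrite !rdist1R.
have -> : 1 - r n ^+ 2 = (1 - r n) * (1 + r n) by ring.
rewrite normrM ler_peMr // ger0_norm; have := r0 n; lra.
Qed.

Lemma near1J z : near1 z -> near1 (fun n => (z n)^*).
Proof.
apply: bsum_le => n; rewrite -[leRHS]rnormJ rmorphB rmorph1 //.
Qed.

Lemma qprod_eq z w : z =1 w -> qprod z = qprod w.
Proof. by move=> /funext ->. Qed.

Lemma qprodM z w : near1 z -> near1 w ->
  qprod (fun n => z n * w n) = qprod z * qprod w.
Proof.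
move=> /near1_net zs /near1_net ws; apply: net_qprod.
have -> : netprod (fun n => z n * w n) = (fun F => netprod z F * netprod w F).
  by apply/funext => F; rewrite /netprod big_split.
exact: (cvg_cmul zs ws).
Qed.

Lemma qprod_finite (F : {fset nat}) z :
  qprod (fun n => if n \in F then z n else 1) = \prod_(n <- F) z n.
Proof.
apply: net_qprod; apply: cvg_near_cst; apply/totallyP; exists F => G FG.
rewrite /netprod (prod_fsub _ FG).
rewrite [X in _ * X]big_seq [X in _ * X]big1 ?mulr1; last first.
  by move=> n; rewrite inE => /andP[/negbTE ->].
by rewrite big_seq [RHS]big_seq; apply: eq_bigr => n ->.
Qed.

(** Dependent, so that it splices sequences of vectors as well as of numbers. [mix F (fun=> 1) w]
    stands for the tail of [w] outside [F]. *)
Definition mix T (F : {fset nat}) (z w : forall n : nat, T n) (n : nat) : T n :=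
  if n \in F then z n else w n.

Lemma near1_mix F z w : near1 w -> near1 (mix F z w).
Proof. by apply: (@near1_cofin F) => n /negbTE nF; rewrite /mix nF. Qed.

Lemma qprod_mix F z w : near1 w ->
  qprod (mix F z w) = \prod_(n <- F) z n * qprod (mix F (fun=> 1) w).
Proof.
move=> ws; rewrite -qprod_finite -qprodM.
- by apply: qprod_eq => n; rewrite /mix; case: ifP; rewrite ?mulr1 ?mul1r.
- by apply: (@near1_cofin F _ _ _ near1_const1) => n /negbTE ->.
- exact: near1_mix.
Qed.

Lemma near1_qprod_tail w : near1 w ->
  (qprod (mix F (fun=> 1) w) : R[i]^o) @[F --> totally] --> (1 : R[i]^o).
Proof.
move=> ws; apply/cvg_netP => e e0.
(* Only a weak inequality survives the passage to the limit, hence the half. *)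
have e20 : 0 < e / 2 by lra.
have [F0 F0e] := near1_tail ws e20.
exists F0 => F F0F; suff : rnorm (qprod (mix F (fun=> 1) w) - 1) <= e / 2 by lra.
have := near1_net (near1_mix F (fun=> 1) ws).
move=> /cvgB/(_ (cvg_cst (1 : R[i]^o)))/cvg_rnorm_bnd; apply.
apply: nearW => G; apply: ltW.
change (rnorm (\prod_(n <- G) mix F (fun=> 1) w n - 1) < e / 2).
rewrite (prod_fsetDI _ G F).
rewrite big_seq big1; last by move=> n; rewrite inE /mix => /andP[_ ->].
rewrite mul1r big_seq; under eq_bigr => n.
  by rewrite inE /mix => /andP[/negbTE -> _]; over.
rewrite -big_seq; apply: F0e; apply/fdisjointP => n /(fsubsetP F0F).
by rewrite inE negb_and => ->.
Qed.

Lemma cvg_qprod_mix z w : near1 z -> near1 w ->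
  (qprod (mix F z w) : R[i]^o) @[F --> totally] --> (qprod z : R[i]^o).
Proof.
move=> zs ws; rewrite -[qprod z]mulr1.
have -> : (fun F => qprod (mix F z w)) =
    (fun F => netprod z F * qprod (mix F (fun=> 1) w)).
  by apply/funext => F; rewrite qprod_mix.
exact: (cvg_cmul (near1_net zs) (near1_qprod_tail ws)).
Qed.

End near1_theory.

(** * Convergence to a nonzero limit forces absolute convergence *)

Section sectors.
Context {R : realType}.
Implicit Types (z : nat -> R[i]).

(* For w in the sector |Im (u w)| <= Re (u w) the growth of the partial products
   from p to (1 + w) p, with p close to 1, goes in the direction of 1/u. *)
Lemma sector_sum (F0 : {fset nat}) z (u : R[i]) (s : seq nat) : rnorm u = 1 ->
  (forall D : {fset nat}, [disjoint F0 & D]%fset ->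
    rnorm (\prod_(n <- D) z n - 1) <= 4^-1) ->
  uniq s ->
  (forall n, n \in s -> n \notin F0 /\
    `|complex.Im (u * (z n - 1))| <= complex.Re (u * (z n - 1))) ->
  \sum_(n <- s) complex.Re (u * (z n - 1)) <=
    2 * complex.Re (u * (\prod_(n <- s) z n - 1)).
Proof.
move=> u1 zD; elim: s => [|k s IH]; first by rewrite !big_nil subrr !mulr0.
move=> /= /andP[ks us] sF; rewrite !big_cons.
have {}IH := IH us (fun n ns => sF n (mem_behead (s := k :: s) ns)).
have [_ kS] := sF k (mem_head _ _).
have : rnorm (\prod_(n <- s) z n - 1) <= 4^-1.
  have := zD (seq_fset tt s).
  rewrite (perm_big _ (seq_fset_perm _ _)) undup_id //; apply.
  rewrite fdisjoint_sym; apply/fdisjointP => n; rewrite seq_fsetE => ns.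
  by have [] := sF n (mem_behead (s := k :: s) ns).
set p := \prod_(n <- s) _ in IH * => p1.
have -> : u * (z k * p - 1) =
  u * (p - 1) + u * (z k - 1) + u * (z k - 1) * (p - 1) by ring.
rewrite !ReD; set a := u * (z k - 1) in kS *.
(* With [|p - 1| <= 1/4] the cross term [a (p - 1)] then costs at most half of [Re a]; the other
   half is what the factor 2 of the statement pays for. *)
have : rnorm a <= 2 * complex.Re a.
  apply: le_trans (rnorm_ReIm _) _.
  have := kS; have := normr_ge0 (complex.Im a); have : 0 <= complex.Re a.
    by apply: le_trans kS.
  move=> h; rewrite (ger0_norm h); lra.
have := rnorm_Re (a * (p - 1)); rewrite rnormM ler_norml => /andP[h _].
have := rnorm_ge0 a; move: (rnorm_ge0 (p - 1)); nra.
Qed.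

(** The four sectors around [1], [-1], [i], [-i] cover the plane. Within one sector, the sum of
    [|z n - 1|] is at most twice that of the [Re (u (z n - 1))], hence at most four times
    [|prod - 1|], that is at most 1. The four sectors together give the 4 in the bound. *)
Lemma near1_of_tails (F0 : {fset nat}) z :
  (forall D : {fset nat}, [disjoint F0 & D]%fset ->
    rnorm (\prod_(n <- D) z n - 1) <= 4^-1) -> near1 z.
Proof.
move=> zD.
pose S (u : R[i]) n :=
  `|complex.Im (u * (z n - 1))| <= complex.Re (u * (z n - 1)).
have SD (D : {fset nat}) u : rnorm u = 1 -> [disjoint F0 & D]%fset ->
    \sum_(n <- D | S u n) rnorm (z n - 1) <= 1.
  move=> u1 F0D; rewrite -big_filter; set s := [seq n <- D | S u n].
  have sP n : n \in s -> n \notin F0 /\ S u n.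
    rewrite mem_filter => /andP[Sn nD]; split=> //.
    by move: F0D; rewrite fdisjoint_sym => /fdisjointP; apply.
  have us : uniq s by rewrite filter_uniq ?fset_uniq.
  have := sector_sum u1 zD us sP.
  have : rnorm (\prod_(n <- s) z n - 1) <= 4^-1.
    have := zD (seq_fset tt s).
    rewrite (perm_big _ (seq_fset_perm _ _)) undup_id //; apply.
    rewrite fdisjoint_sym; apply/fdisjointP => n; rewrite seq_fsetE => ns.
    by have [] := sP n ns.
  have := rnorm_Re (u * (\prod_(n <- s) z n - 1)).
  rewrite rnormM u1 mul1r ler_norml => /andP[_ h1] h2 h3.
  suff : \sum_(n <- s) rnorm (z n - 1) <=
      2 * \sum_(n <- s) complex.Re (u * (z n - 1)) by lra.
  rewrite mulr_sumr big_seq [leRHS]big_seq; apply: ler_sum => n /sP[_ Sn].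
  have -> : rnorm (z n - 1) = rnorm (u * (z n - 1)) by rewrite rnormM u1 mul1r.
  apply: le_trans (rnorm_ReIm _) _.
  rewrite (@ger0_norm _ (complex.Re _)); last exact: le_trans Sn.
  rewrite /S in Sn; lra.
have i1 : rnorm ('i%C : R[i]) = 1.
  by rewrite /rnorm normc_def /= expr0n add0r expr1n sqrtr1.
exists (\sum_(n <- F0) rnorm (1 - z n) + 4) => F.
rewrite (sum_fsetDI _ F F0) lerD //.
  by apply: sum_fset_sub (fsubsetIr _ _) => n; exact: rnorm_ge0.
set D := (F `\` F0)%fset.
have F0D : [disjoint F0 & D]%fset.
  by apply/fdisjointP => n nF; rewrite inE nF.
have D1 := SD D 1 rnorm1 F0D.
have D2 := SD D (-1) (etrans (rnormN _) rnorm1) F0D.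
have D3 := SD D 'i%C i1 F0D.
have D4 := SD D (- 'i%C) (etrans (rnormN _) i1) F0D.
apply: (@le_trans _ _ (\sum_(n <- D | S 1 n) rnorm (z n - 1) +
  \sum_(n <- D | S (-1) n) rnorm (z n - 1) +
  \sum_(n <- D | S 'i%C n) rnorm (z n - 1) +
  \sum_(n <- D | S (- 'i%C) n) rnorm (z n - 1))); last by lra.
rewrite (big_mkcond (S 1)) (big_mkcond (S (-1))) (big_mkcond (S 'i%C)).
rewrite (big_mkcond (S (- 'i%C))) /= -!big_split /=; apply: ler_sum => n _.
rewrite rdistC; have := rnorm_ge0 (z n - 1); rewrite /S.
case: (z n - 1) => a b /=; move: (rnorm _) => r r0.
have abs (x y : R) : (`|x| <= y) = (- y <= x) && (x <= y) by rewrite ler_norml.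
rewrite !abs; case: ifP; case: ifP; case: ifP; case: ifP; lra.
Qed.

Lemma net_near1 z (a : R[i]) : netprod z @ totally --> (a : R[i]^o) -> a != 0 -> near1 z.
Proof.
move=> /cvg_netP za; rewrite -rnorm_gt0 => a0.
(* If [p] and [p q] are within [|a| / 10] of [a], then [|q - 1| < (2/10) / (9/10) = 2/9], below the
   threshold 1/4. *)
have [F0 F0e] := za (rnorm a / 10) ltac:(lra).
apply: (@near1_of_tails F0) => D F0D.
have := F0e _ (fsubset_refl _); have := F0e _ (fsubsetUl F0 D).
rewrite /netprod (prod_fsetU _ F0D); set p := \prod_(n <- F0) _; set q := \prod_(n <- D) _.
move=> h1 h2; have := rdistD a (p * q) p; rewrite (rdistC a) -[X in _ * q - X]mulr1.
rewrite -mulrBr rnormM; have := rnorm_sub_le a (a - p).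
have -> : a - (a - p) = p by ring.
rewrite (rdistC a p); move: (rnorm (q - 1)) (rnorm_ge0 (q - 1)) => x x0.
move: (rnorm (p - a)) (rnorm (p * q - a)) (rnorm p) (rnorm a) a0 h1 h2.
by move=> y1 y2 rp ra; nra.
Qed.

End sectors.

(** * A rearrangement that visits given finite sets moving off to infinity *)

Section block_permutation.
Variables (D : nat -> {fset nat}).
Hypothesis DN : forall N n, n \in D N -> (N <= n)%N.

(** Consecutive intervals [[N, next N)], the one starting at [N] long enough to contain [D N],
    partition the natural numbers. [block N] lists such an interval with [D N] in front, and the
    permutation concatenates the blocks. *)
Let next N := (maxn N (\max_(n <- D N) n)).+1.

Let block N := (D N : seq nat) ++ [seq n <- iota N (next N - N) | n \notin D N].

Let lt_next N : (N < next N)%N.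
Proof. by rewrite ltnS leq_maxl. Qed.

Let lt_D N n : n \in D N -> (n < next N)%N.
Proof. by move=> nD; rewrite ltnS leq_max (leq_bigmax_seq _ nD) ?orbT. Qed.

Let perm_block N : perm_eq (block N) (iota N (next N - N)).
Proof.
set s := iota _ _; apply: (@perm_trans _ ([seq n <- s | n \in D N] ++
  [seq n <- s | n \notin D N])); last by rewrite (perm_filterC (mem (D N))).
rewrite perm_cat2r uniq_perm ?fset_uniq // ?filter_uniq ?iota_uniq //.
move=> n; rewrite mem_filter mem_iota subnKC ?(ltnW (lt_next N)) //=.
by case: (boolP (n \in D N)) => // nD; rewrite (DN nD) lt_D.
Qed.

Let size_block N : size (block N) = (next N - N)%N.
Proof. by rewrite (perm_size (perm_block N)) size_iota. Qed.

Let uniq_block N : uniq (block N).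
Proof. by rewrite (perm_uniq (perm_block N)) iota_uniq. Qed.

Let mem_block N n : (n \in block N) = (N <= n < next N)%N.
Proof.
by rewrite (perm_mem (perm_block N)) mem_iota subnKC ?(ltnW (lt_next N)).
Qed.

Let start k := iter k next 0.

Let start_ge k : (k <= start k)%N.
Proof. by elim: k => // k IH; apply: leq_ltn_trans IH (lt_next _). Qed.

Let start_mono j k : (j <= k)%N -> (start j <= start k)%N.
Proof.
elim: k => [|k IH]; first by rewrite leqn0 => /eqP ->.
by rewrite leq_eqVlt => /predU1P[->//|/IH]; move/leq_trans; apply; apply/ltnW/lt_next.
Qed.

Let index_ex n : exists k, (n < start k.+1)%N.
Proof. by exists n; apply: leq_trans (start_ge _). Qed.

Let idx n := ex_minn (index_ex n).

Let idxP n : (start (idx n) <= n < next (start (idx n)))%N.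
Proof.
rewrite /idx; case: ex_minnP => -[|k] nk kmin; rewrite nk andbT //.
by rewrite leqNgt; apply/negP => /kmin; rewrite ltnn.
Qed.

Let idxE k n : (start k <= n < next (start k))%N -> idx n = k.
Proof.
move=> /andP[kn nk]; have /andP[in_ ni] := idxP n.
apply/eqP; rewrite eqn_leq; apply/andP; split; rewrite leqNgt; apply/negP => h.
  by have := leq_trans (start_mono h) in_; rewrite leqNgt nk.
by have := leq_trans (start_mono h) kn; rewrite leqNgt ni.
Qed.

Let perm n := nth 0 (block (start (idx n))) (n - start (idx n)).
Let invperm n := (start (idx n) + index n (block (start (idx n))))%N.

Let perm_in n : (start (idx n) <= perm n < next (start (idx n)))%N.
Proof.
rewrite -mem_block mem_nth // size_block; have /andP[h1 h2] := idxP n.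
by rewrite ltn_sub2r // lt_next.
Qed.

Let invperm_in n : (start (idx n) <= invperm n < next (start (idx n)))%N.
Proof.
rewrite leq_addr /= /invperm.
have : (index n (block (start (idx n))) < size (block (start (idx n))))%N.
  by rewrite index_mem mem_block idxP.
by rewrite size_block ltn_subRL.
Qed.

(* The permutation visits D M first in the block starting at M; if the products
   over all D M stay away from 1, the partial products along it are not Cauchy. *)
Lemma block_permutation : exists2 s : nat -> nat, bijective s &
  forall N, exists M : nat, exists2 k : nat, (N <= M)%N &
    forall (K : comNzRingType) (z : nat -> K),
    \prod_(n < M + k) z (s n) = \prod_(n < M) z (s n) * \prod_(n <- D M) z n.
Proof.
exists perm.
  exists invperm => n.
    rewrite /invperm (idxE (perm_in n)) /perm index_uniq ?uniq_block //.
      by rewrite subnKC //; have /andP[] := idxP n.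
    rewrite size_block; have /andP[h1 h2] := idxP n.
    by rewrite ltn_sub2r // lt_next.
  rewrite /perm (idxE (invperm_in n)) /invperm addKn nth_index //.
  by rewrite mem_block idxP.
move=> N; exists (start N); exists (size (D (start N))); first exact: start_ge.
move=> K z; rewrite big_split_ord /=; congr (_ * _).
rewrite (big_nth 0) big_mkord; apply: eq_bigr => i _.
have iE : idx (start N + i) = N.
  apply: idxE; rewrite leq_addr /= -ltn_subRL -size_block size_cat.
  by rewrite ltn_addr.
by rewrite /perm iE addKn nth_cat ltn_ord.
Qed.

End block_permutation.

(** * From rearrangements back to finite sets; domination of products *)

Section uncond.
Context {R : realType}.
Implicit Types (z w : nat -> R[i]) (u v : nat -> R).

(** If [near1] failed, [near1_of_tails] with the first [N] indices excluded would give, beyond every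
    [N], a set [D N] whose product is more than 1/4 away from 1. The block permutation multiplies
    partial products arbitrarily far out by such a factor, although both the old and the new one are
    within [|a| / 10] of [a]. *)
Lemma uncond_near1 z a : uncond_prod z a -> a != 0 -> near1 z.
Proof.
move=> za; rewrite -rnorm_gt0 => a0; apply: contrapT => zn.
have /choice[D DP] (N : nat) : exists D : {fset nat},
    (forall n, n \in D -> (N <= n)%N) /\ 4^-1 < rnorm (\prod_(n <- D) z n - 1).
  apply: contrapT => zN; apply: zn; apply: (@near1_of_tails _ (fimage id N)) => D ND.
  rewrite leNgt; apply/negP => D4; apply: zN; exists D; split=> // n.
  rewrite leqNgt => nD; apply/negP => nN; move: ND; rewrite fdisjoint_sym.
  move=> /fdisjointP/(_ n nD); rewrite seq_fsetE map_id mem_iota /= add0n.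
  by rewrite nN.
have [s sb sP] := block_permutation (fun N => (DP N).1).
have /cvg_rnormP/(_ (rnorm a / 10) ltac:(lra))[N _ Na] := za s sb.
have [M [k NM Mk]] := sP N.
have := Na M NM; have := Na (M + k)%N (leq_trans NM (leq_addr _ _)).
rewrite /= (Mk _ z); have [_] := DP M.
set p := \prod_(n < M) _; set q := \prod_(n <- D M) _.
move=> h0 h1 h2; have := rdistD a (p * q) p; rewrite (rdistC a) -[X in _ * q - X]mulr1.
rewrite -mulrBr rnormM; have := rnorm_sub_le a (a - p).
rewrite subKr (rdistC a p).
move: (rnorm (q - 1)) (rnorm (p - a)) (rnorm (p * q - a)) (rnorm p) (rnorm a) a0 h0 h1 h2.
by move=> x y1 y2 rp ra; nra.
Qed.

Lemma uncond_net z a : uncond_prod z a -> a != 0 -> netprod z @ totally --> (a : R[i]^o).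
Proof. by move=> za /(uncond_near1 za)/near1_net; rewrite (qprodE za). Qed.

Lemma uncond_neq0 z a n : uncond_prod z a -> a != 0 -> z n != 0.
Proof. by move=> za a0; apply: net_neq0 (uncond_net za a0) a0. Qed.

Lemma uncond_prodM z w a b : uncond_prod z a -> uncond_prod w b ->
  uncond_prod (fun n => z n * w n) (a * b).
Proof.
move=> za wb s sb; have -> : (fun N => \prod_(n < N) (z (s n) * w (s n))) =
  (fun N => \prod_(n < N) z (s n) * \prod_(n < N) w (s n)).
  by apply/funext => N; rewrite big_split.
exact: (cvg_cmul (za s sb) (wb s sb)).
Qed.

Lemma uncond_prod_le0 z w : (forall n, rnorm (z n) <= rnorm (w n)) ->
  uncond_prod w 0 -> uncond_prod z 0.
Proof.
move=> zw w0 s sb; apply/cvg_rnormP => e e0.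
have /cvg_rnormP/(_ e e0) := w0 s sb.
apply: filterS => N; rewrite !subr0; apply: le_lt_trans.
rewrite !rnorm_prod; apply: ler_prod => n _; rewrite rnorm_ge0; exact: zw.
Qed.

(** The products decrease along the net, so their infimum is the limit. *)
Lemma decr_net u : (forall n, 0 <= u n <= 1) ->
  exists a : R, netprod (fun n => (u n)%:C%C) @ totally --> (a%:C%C : R[i]^o).
Proof.
move=> u01.
pose S := [set \prod_(n <- F) u n | F in [set: {fset nat}]].
have p0 (F : {fset nat}) : 0 <= \prod_(n <- F) u n.
  by apply: prodr_ge0 => n _; have /andP[] := u01 n.
have infS : has_inf S.
  split; first by exists (\prod_(n <- fset0) u n), fset0.
  by exists 0 => _ [F _ <-].
exists (inf S); apply/cvg_netP => e e0.
have [_ [F0 _ <-] F0e] := inf_adherent e0 infS.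
exists F0 => F F0F; rewrite /netprod -rmorph_prod -rmorphB rnormR.
have lF : inf S <= \prod_(n <- F) u n by apply: (ge_inf infS.2); exists F.
rewrite ger0_norm ?subr_ge0 // ltrBlDl (le_lt_trans _ F0e) //.
rewrite (prod_fsub _ F0F) ler_piMr //.
have : \prod_(n <- (F `\` F0)%fset) u n <= \prod_(n <- (F `\` F0)%fset) 1.
  by apply: ler_prod => n _; exact: u01.
by rewrite big1_eq.
Qed.

(** A zero of [v] is a zero of [u] and kills the product. Otherwise [u = (u / v) v], where the
    ratios lie in [[0, 1]] and have a monotone product. *)
Lemma near1_dominated u v : (forall n, 0 <= u n <= v n) ->
  near1 (fun n => (v n)%:C%C : R[i]) ->
  exists a : R[i], netprod (fun n => (u n)%:C%C) @ totally --> (a : R[i]^o).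
Proof.
move=> uv v1; have [[n vn]|vn] := pselect (exists n, v n = 0).
  have un : u n = 0 by have := uv n; rewrite vn -eq_le eq_sym => /eqP.
  exists 0; apply/cvg_netP => e e0.
  exists [fset n]%fset => F nF; rewrite /netprod (prod_fsub _ nF) big_seq_fset1 un.
  by rewrite mul0r subrr rnorm0.
have v0 n : 0 < v n.
  have /andP[h1 h2] := uv n; rewrite lt_def (le_trans h1 h2) andbT.
  by apply/eqP => vn0; apply: vn; exists n.
have [n|a ra] := @decr_net (fun n => u n / v n).
  have /andP[h1 h2] := uv n.
  by rewrite divr_ge0 ?(ltW (v0 n)) //= ler_pdivrMr // mul1r.
exists (a%:C%C * qprod (fun n => (v n)%:C%C)).
have -> : netprod (fun n => (u n)%:C%C) = (fun F =>
  netprod (fun n => (u n / v n)%:C%C) F * netprod (fun n => (v n)%:C%C) F).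
  apply/funext => F; rewrite /netprod -big_split /=; apply: eq_bigr => n _.
  by rewrite -rmorphM /= divfK ?gt_eqF.
exact: (cvg_cmul ra (near1_net v1)).
Qed.

Lemma uncond_dominated u v b : (forall n, 0 <= u n <= v n) ->
  uncond_prod (fun n => (v n)%:C%C : R[i]) b ->
  exists a : R[i], uncond_prod (fun n => (u n)%:C%C) a.
Proof.
move=> uv vb; have [b0|b0] := eqVneq b 0.
  exists 0; rewrite b0 in vb; apply: uncond_prod_le0 vb => n.
  have /andP[h1 h2] := uv n; rewrite !rnormR !ger0_norm //; exact: le_trans h2.
have [a ua] := near1_dominated uv (uncond_near1 vb b0).
by exists a; exact: net_uncond.
Qed.

End uncond.

(** * C-sequences and their equivalence *)

Section sequences.
Context {R : realType} {H : nat -> hilbertType R}.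
Implicit Types (h f g : forall n, H n).

Lemma C0seqE h : is_C0seq h <-> near1 (fun n => (rnorm (h n))%:C%C).
Proof.
rewrite /is_C0seq abs_summableP.
by under eq_fun do rewrite rnormE.
Qed.

Lemma C0seq_sqr h : is_C0seq h <-> near1 (fun n => (rnorm (h n) ^+ 2)%:C%C).
Proof. by rewrite C0seqE near1_sqr // => n; exact: rnorm_ge0. Qed.

Lemma C0_equivE h f : C0_equiv h f <-> near1 (fun n => inner (h n) (f n)).
Proof. exact: abs_summableP. Qed.

Lemma C0_equiv_refl h : is_C0seq h -> C0_equiv h h.
Proof. by rewrite C0seq_sqr C0_equivE; under eq_fun do rewrite -inner_rnorm. Qed.

Lemma C0_equiv_sym h f : C0_equiv h f -> C0_equiv f h.
Proof.
rewrite !C0_equivE => /near1J; congr near1.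
by apply/funext => n; rewrite -innerC.
Qed.

(** [|h - f|^2 = (|h|^2 - 1) + (|f|^2 - 1) + 2 Re (1 - <h, f>)], and all three terms are
    summable. *)
Lemma C0_equiv_dist h f : is_C0seq h -> is_C0seq f -> C0_equiv h f ->
  bsum (fun n => rnorm (h n - f n) ^+ 2).
Proof.
move=> /C0seq_sqr hs /C0seq_sqr fs /C0_equivE hf.
have d2 : 0 <= (2 : R) by lra.
apply: bsum_le (bsumD (bsumD hs fs) (bsumZ d2 hf)) => n.
rewrite rnormB2 !rdist1R.
have := rnorm_Re (1 - inner (h n) (f n)); rewrite ReB /= => /ler_normlP[h1 h2].
have := ler_norm (rnorm (h n) ^+ 2 - 1); have := ler_norm (rnorm (f n) ^+ 2 - 1).
rewrite (distrC (rnorm (h n) ^+ 2)) (distrC (rnorm (f n) ^+ 2)).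
by lra.
Qed.

Lemma inner_le_sqr (V : hilbertType R) (u v : V) :
  rnorm (inner u v) <= 2^-1 * rnorm u ^+ 2 + 2^-1 * rnorm v ^+ 2.
Proof.
apply: le_trans (inner_CauchySchwarz u v) _; have := sqr_ge0 (rnorm u - rnorm v).
by nra.
Qed.

(** [1 - <h, f>] is [(1 - <h, g>) + (1 - <g, f>) - (1 - |g|^2) + <h - g, g - f>]; the last term is
    summable because both differences are square summable. *)
Lemma C0_equiv_trans g h f : is_C0seq h -> is_C0seq g -> is_C0seq f ->
  C0_equiv h g -> C0_equiv g f -> C0_equiv h f.
Proof.
move=> hs gs fs hg gf; apply/C0_equivE.
have i2 : 0 <= (2^-1 : R) by lra.
have d1 := bsumZ i2 (C0_equiv_dist hs gs hg).
have d2 := bsumZ i2 (C0_equiv_dist gs fs gf).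
move/C0_equivE: hg => hg; move/C0_equivE: gf => gf; move/C0seq_sqr: gs => gs.
apply: near1_le (bsumD (bsumD hg gf) (bsumD gs (bsumD d1 d2))) => n.
have -> : 1 - inner (h n) (f n) = (1 - inner (h n) (g n)) + (1 - inner (g n) (f n))
    + (- (1 - (rnorm (g n) ^+ 2)%:C%C) + inner (h n - g n) (g n - f n)).
  rewrite innerBl !innerBr -inner_rnorm; ring.
apply: le_trans (rnormD _ _) _; apply: lerD; first exact: rnormD.
apply: le_trans (rnormD _ _) _; rewrite rnormN; apply: lerD => //.
exact: inner_le_sqr.
Qed.

Lemma C0_cofin (F : {fset nat}) h f : (forall n, n \notin F -> f n = h n) ->
  is_C0seq h -> is_C0seq f.
Proof.
move=> fh /C0seqE hs; apply/C0seqE.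
by apply: (@near1_cofin _ F _ _ _ hs) => n /fh ->.
Qed.

Lemma C0_equiv_cofin (F : {fset nat}) h f g : (forall n, n \notin F -> f n = h n) ->
  C0_equiv h g -> C0_equiv f g.
Proof.
move=> fh /C0_equivE hs; apply/C0_equivE.
by apply: (@near1_cofin _ F _ _ _ hs) => n /fh ->.
Qed.

Lemma C0_Cseq h : is_C0seq h -> is_Cseq h.
Proof.
move=> /C0seqE/near1_uncond hs; exists (qprod (fun n => (rnorm (h n))%:C%C)).
by move: hs; congr uncond_prod; apply/funext => n; rewrite rnormE.
Qed.

(** [live] and [dead] are the two cases of a C-sequence. A C0-sequence with a zero entry is
    [dead]. *)
Definition live h := is_C0seq h /\ forall n, h n != 0.

Definition dead h := uncond_prod (fun n => (rnorm (h n))%:C%C) 0.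

Lemma Cseq_live_dead h : is_Cseq h -> live h \/ dead h.
Proof.
move=> [a ha]; have {}ha : uncond_prod (fun n => (rnorm (h n))%:C%C) a.
  by move: ha; congr uncond_prod; apply/funext => n; rewrite rnormE.
have [a0|a0] := eqVneq a 0; first by right; rewrite /dead -a0.
left; split; first exact/C0seqE/(uncond_near1 ha).
move=> n; have := uncond_neq0 n ha a0; apply: contraNneq => ->.
by rewrite rnorm0.
Qed.

Lemma live_not_dead h : live h -> ~ dead h.
Proof.
move=> [/C0seqE hs h0] hd; have /eqP := qprodE hd.
apply/negP; apply: near1_neq0 hs _ => n.
by rewrite -rnorm_gt0 rnormR normr_gt0 rnorm_eq0 h0.
Qed.

Lemma Cseq_bounded h : is_Cseq h ->
  exists b : R[i], uncond_prod (fun n => (rnorm (h n))%:C%C) b.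
Proof.
move=> [a ha]; exists a.
by move: ha; congr uncond_prod; apply/funext => n; rewrite rnormE.
Qed.

Lemma inner_dead h f : is_Cseq h -> is_Cseq f -> dead h \/ dead f ->
  uncond_prod (fun n => inner (h n) (f n)) 0.
Proof.
move=> /Cseq_bounded[a ha] /Cseq_bounded[b fb] hf.
have : uncond_prod (fun n => (rnorm (h n) * rnorm (f n))%:C%C) 0.
  under eq_fun do rewrite rmorphM /=.
  case: hf => d; first by rewrite -(mul0r b); exact: (uncond_prodM d fb).
  by rewrite -(mulr0 a); exact: (uncond_prodM ha d).
apply: uncond_prod_le0 => n; rewrite rnormR ger0_norm ?mulr_ge0 ?rnorm_ge0 //.
exact: inner_CauchySchwarz.
Qed.

(** Describes when the product of the [<h_n, f_n>] converges to its quasi-value without further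
    inspection; unrelated pairs have quasi-value 0. The case [h = f] makes the relation reflexive
    also on dead sequences. *)
Definition tensor_rel h f := h = f \/ [/\ live h, live f & C0_equiv h f].

Lemma tensor_rel_sym h f : tensor_rel h f -> tensor_rel f h.
Proof.
by case=> [->|[lh lf hf]]; [left|right; split=> //; exact: C0_equiv_sym].
Qed.

Lemma tensor_rel_trans g h f : tensor_rel h g -> tensor_rel g f -> tensor_rel h f.
Proof.
case=> [-> //|[lh lg hg]] [<-|[_ lf gf]]; right; split=> //.
exact: C0_equiv_trans lh.1 lg.1 lf.1 hg gf.
Qed.

(** * Transport of C0-sequences and of their equivalence by the operators *)

Section defect.
Variables (A : forall n, {linear H n -> H n}) (c : nat -> R).
Hypotheses (c0 : forall n, 0 <= c n) (cs : near1 (fun n => (c n)%:C%C : R[i])).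
Hypothesis Ac : forall n u, rnorm (A n u) ^+ 2 <= c n * rnorm u ^+ 2.

(** The value [q_n(h_n, h_n)] of the positive form. For a C0-sequence [h], its summability means
    that [A h] is again a C0-sequence, and it depends only on the equivalence class of [h]. *)
Definition defect h n := c n * rnorm (h n) ^+ 2 - rnorm (A n (h n)) ^+ 2.

Lemma defect_ge0 h n : 0 <= defect h n.
Proof. by rewrite subr_ge0. Qed.

(** [c_n |h_n|^2] is near 1, so [|A_n h_n|^2] is near 1 exactly when the difference is summable. *)
Lemma defect_C0 h : is_C0seq h -> is_C0seq (app_seq A h) <-> bsum (defect h).
Proof.
move=> /C0seq_sqr hs; have := near1M cs hs.
under eq_fun do rewrite -rmorphM; move=> chs; rewrite C0seq_sqr; split=> d.
  apply: bsum_le (bsumD chs d) => n; rewrite /defect !rdist1R.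
  have := ler_norm (c n * rnorm (h n) ^+ 2 - 1).
  have := ler_norm (1 - rnorm (app_seq A h n) ^+ 2).
  rewrite (distrC (_ * _)) /app_seq; lra.
apply: near1_le (bsumD chs d) => n; rewrite !rdist1R.
have := ler_normD (1 - c n * rnorm (h n) ^+ 2) (defect h n).
by rewrite (ger0_norm (defect_ge0 h n)) {1}/defect addrA subrK.
Qed.

Lemma defect_inner h f : bsum (defect h) -> bsum (defect f) ->
  bsum (fun n => rnorm ((c n)%:C%C * inner (h n) (f n) -
    inner (app_seq A h n) (app_seq A f n))).
Proof.
move=> dh df; have i2 : 0 <= (2^-1 : R) by lra.
apply: bsum_le (bsumZ i2 (bsumD dh df)) => n.
rewrite [leRHS]mulrC; apply: (defect_form_le (A := A n)) => u; exact: Ac.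
Qed.

(** [1 - <A h, A f>] and [1 - <h, f>] differ by [c <h, f> - <A h, A f>], summable by [defect_inner],
    and by [(1 - c) <h, f>], where [<h, f>] is bounded. *)
Lemma defect_equiv h f : is_C0seq h -> is_C0seq f ->
  bsum (defect h) -> bsum (defect f) ->
  C0_equiv (app_seq A h) (app_seq A f) <-> C0_equiv h f.
Proof.
move=> hs fs dh df; have d := defect_inner dh df; rewrite !C0_equivE.
have [M M0 hM] : exists2 M, 0 <= M & forall n, rnorm (inner (h n) (f n)) <= M.
  move/C0seqE/near1_bounded: hs => [M1 M10 hM].
  move/C0seqE/near1_bounded: fs => [M2 M20 fM].
  exists (M1 * M2) => [|n]; first exact: mulr_ge0.
  apply: le_trans (inner_CauchySchwarz _ _) _; have := hM n; have := fM n.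
  by rewrite !rnormR !ger0_norm ?rnorm_ge0 // => ? ?; apply: ler_pM; rewrite ?rnorm_ge0.
have cM := bsumZ M0 cs.
split=> k; apply: near1_le (bsumD k (bsumD d cM)) => n.
  set q := inner (h n) _; set p := inner (app_seq A h n) _.
  have -> : 1 - q = (1 - p) + (- ((c n)%:C%C * q - p) - q * (1 - (c n)%:C%C)) by ring.
  apply: le_trans (rnormD _ _) _; apply: lerD => //.
  apply: le_trans (rnormB _ _) _; rewrite rnormN; apply: lerD => //.
  by rewrite rnormM ler_wpM2r ?rnorm_ge0 ?hM.
set q := inner (h n) _; set p := inner (app_seq A h n) _.
have -> : 1 - p = (1 - q) + (((c n)%:C%C * q - p) + q * (1 - (c n)%:C%C)) by ring.
apply: le_trans (rnormD _ _) _; apply: lerD => //.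
apply: le_trans (rnormD _ _) _; apply: lerD => //.
by rewrite rnormM ler_wpM2r ?rnorm_ge0 ?hM.
Qed.

(* The defect is a positive quadratic form, so defect f <= 2 defect h + 2 defect (f - h). *)
Lemma defect_bsum h f : is_C0seq h -> is_C0seq f -> C0_equiv h f ->
  bsum (defect h) -> bsum (defect f).
Proof.
move=> hs fs hf dh; have [M M0 cM0] := near1_bounded cs.
have cM n : c n <= M by have := cM0 n; rewrite rnormR ger0_norm.
have d2 : 0 <= (2 : R) by lra.
apply: bsum_le (bsumD (bsumZ d2 dh) (bsumZ d2 (bsumZ M0 (C0_equiv_dist hs fs hf)))).
move=> n; pose d := h n - f n; have fE : f n = h n - d by rewrite /d subKr.
have cd : c n * rnorm d ^+ 2 <= M * rnorm d ^+ 2 by rewrite ler_wpM2r ?sqr_ge0.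
(* Parallelogram law for the form: the value at [u + v] is dropped as nonnegative, and [- |A v|^2]
   as nonpositive, so that only the square summable [|v|^2] remains of the difference. *)
have key u v : c n * rnorm (u - v) ^+ 2 - rnorm (A n (u - v)) ^+ 2 <=
    2 * (c n * rnorm u ^+ 2 - rnorm (A n u) ^+ 2) + 2 * (c n * rnorm v ^+ 2).
  have := Ac (u + v); have := sqr_ge0 (rnorm (A n v)).
  rewrite linearB linearD /= (rnormD2 u v) (rnormB2 u v).
  rewrite (rnormD2 (A n u)) (rnormB2 (A n u)); lra.
have := key (h n) d; rewrite -fE /defect -/d; lra.
Qed.

Let sqrt_near1 : near1 (fun n => (Num.sqrt (c n))%:C%C : R[i]).
Proof.
apply: (near1_sqr (fun n => sqrtr_ge0 (c n))).2.
by move: cs; congr near1; apply/funext => n; rewrite sqr_sqrtr.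
Qed.

Let app_le h n : rnorm (app_seq A h n) <= Num.sqrt (c n) * rnorm (h n).
Proof.
rewrite -(@ler_pXn2r _ 2) ?nnegrE ?mulr_ge0 ?sqrtr_ge0 ?rnorm_ge0 //=.
by rewrite exprMn sqr_sqrtr //; exact: Ac.
Qed.

Let app_uncond h b : uncond_prod (fun n => (rnorm (h n))%:C%C) b ->
  uncond_prod (fun n => (Num.sqrt (c n) * rnorm (h n))%:C%C : R[i])
    (qprod (fun n => (Num.sqrt (c n))%:C%C) * b).
Proof.
move=> /(uncond_prodM (near1_uncond sqrt_near1)); congr uncond_prod.
by apply/funext => n; rewrite rmorphM.
Qed.

Lemma app_Cseq h : is_Cseq h -> is_Cseq (app_seq A h).
Proof.
move=> /Cseq_bounded[b /app_uncond hb].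
have [|a ua] := @uncond_dominated _ (fun n => rnorm (app_seq A h n)) _ _ _ hb.
  by move=> n; rewrite rnorm_ge0 app_le.
exists a; move: ua; congr uncond_prod.
by apply/funext => n; rewrite rnormE.
Qed.

Lemma app_dead h : dead h -> dead (app_seq A h).
Proof.
move=> /app_uncond; rewrite mulr0; apply: uncond_prod_le0 => n.
by rewrite !rnormR !ger0_norm ?mulr_ge0 ?sqrtr_ge0 ?rnorm_ge0 ?app_le.
Qed.

(** If [A h] is dead, the product tends to 0. If it is live, [h] has summable defect, equivalence
    hands this on to [f], and [A h] is equivalent to [A f]. *)
Lemma app_inner_rel h f : is_Cseq h -> is_Cseq f -> tensor_rel h f ->
  uncond_prod (fun n => inner (app_seq A h n) (app_seq A f n))
    (qprod (fun n => inner (app_seq A h n) (app_seq A f n))).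
Proof.
move=> hC fC [<-|[[hs h0] [fs f0] hf]].
  have [a ha] := Cseq_bounded (app_Cseq hC); have := uncond_prodM ha ha.
  have -> : (fun n => (rnorm (app_seq A h n))%:C%C * (rnorm (app_seq A h n))%:C%C) =
    (fun n => inner (app_seq A h n) (app_seq A h n)).
    by apply/funext => n; rewrite inner_rnorm -rmorphM expr2.
  by move=> k; rewrite (qprodE k).
have AhC := app_Cseq hC; have AfC := app_Cseq fC.
have deadcase : dead (app_seq A h) \/ dead (app_seq A f) ->
  uncond_prod (fun n => inner (app_seq A h n) (app_seq A f n))
    (qprod (fun n => inner (app_seq A h n) (app_seq A f n))).
  by move=> d; have k := inner_dead AhC AfC d; rewrite (qprodE k).
case: (Cseq_live_dead AhC) => [[Ahs _]|d]; last by apply: deadcase; left.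
have dh := (defect_C0 hs).1 Ahs; have df := defect_bsum hs fs hf dh.
exact/near1_uncond/C0_equivE/(defect_equiv hs fs dh df).
Qed.

(** A nonzero quasi-value is a genuine limit and makes [A h] and [A f] equivalent. Dead sequences
    have dead images, so [h] and [f] are live, and [defect_equiv] pulls the equivalence back. *)
Lemma app_inner_unrel h f : is_Cseq h -> is_Cseq f -> ~ tensor_rel h f ->
  qprod (fun n => inner (app_seq A h n) (app_seq A f n)) = 0.
Proof.
move=> hC fC nhf; have AhC := app_Cseq hC; have AfC := app_Cseq fC.
have deadcase : dead (app_seq A h) \/ dead (app_seq A f) ->
    qprod (fun n => inner (app_seq A h n) (app_seq A f n)) = 0.
  by move=> d; exact: qprodE (inner_dead AhC AfC d).
case: (Cseq_live_dead AhC) => [Ahl|d]; last by apply: deadcase; left.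
case: (Cseq_live_dead AfC) => [Afl|d]; last by apply: deadcase; right.
have lh : live h.
  by case: (Cseq_live_dead hC) => // d; case: (live_not_dead Ahl); exact: app_dead.
have lf : live f.
  by case: (Cseq_live_dead fC) => // d; case: (live_not_dead Afl); exact: app_dead.
apply/eqP; apply: contrapT => /negP k; apply: nhf; right; split=> //.
apply/(defect_equiv lh.1 lf.1).
- by apply/(defect_C0 lh.1); case: Ahl.
- by apply/(defect_C0 lf.1); case: Afl.
- apply/C0_equivE; exact: uncond_near1 (qprod_neq0 k) k.
Qed.

End defect.

Lemma near1_1 : near1 (fun=> (1 : R)%:C%C : R[i]).
Proof. exact: near1_const1. Qed.

Lemma id_bound n (u : H n) : rnorm ((idfun : {linear H n -> H n}) u) ^+ 2 <= 1 * rnorm u ^+ 2.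
Proof. by rewrite mul1r. Qed.

(** The identity operators, with [c = 1]. *)
Lemma inner_rel h f : is_Cseq h -> is_Cseq f -> tensor_rel h f ->
  uncond_prod (fun n => inner (h n) (f n)) (qprod (fun n => inner (h n) (f n))).
Proof. exact: (app_inner_rel (fun=> ler01) near1_1 id_bound). Qed.

Lemma inner_unrel h f : is_Cseq h -> is_Cseq f -> ~ tensor_rel h f ->
  qprod (fun n => inner (h n) (f n)) = 0.
Proof. exact: (app_inner_unrel (fun=> ler01) near1_1 id_bound). Qed.

End sequences.

(** * Gram matrices of elementary tensors *)

Lemma cvg_csum {R : realType} (I : Type) (s : seq I) (f : nat -> I -> R[i]^o)
    (l : I -> R[i]^o) :
  (forall i, f N i @[N --> \oo] --> l i) ->
  (\sum_(i <- s) f N i : R[i]^o) @[N --> \oo] --> (\sum_(i <- s) l i : R[i]^o).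
Proof.
move=> fl; elim: s => [|i s IH].
  by under eq_fun do rewrite big_nil; rewrite big_nil; exact: cvg_cst.
under eq_fun do rewrite big_cons; rewrite big_cons.
exact: (@cvgD R[i] R[i]^o _ _ _ (f^~ i) _ _ _ (fl i) IH).
Qed.

Section schur.
Local Open Scope sesquilinear_scope.
Context {R : realType} {m : nat}.
Implicit Types (K L : 'I_m -> 'I_m -> R[i]) (a : 'I_m -> R[i]).

Definition form_sum K a : R[i] := \sum_i \sum_j a i * (a j)^* * K i j.

Definition psd K := (forall i j, K j i = (K i j)^*) /\
  forall a, 0 <= form_sum K a.

Lemma form_sumD K L a :
  form_sum (fun i j => K i j + L i j) a = form_sum K a + form_sum L a.
Proof.
rewrite /form_sum -big_split; apply: eq_bigr => i _.
by rewrite -big_split; apply: eq_bigr => j _; rewrite /= mulrDr.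
Qed.

Lemma psdD K L : psd K -> psd L -> psd (fun i j => K i j + L i j).
Proof.
move=> [Kh K0] [Lh L0]; split=> [i j|a]; first by rewrite Kh Lh rmorphD.
by rewrite form_sumD addr_ge0.
Qed.

(** Unitary diagonalisation writes [L] as a sum of rank-one matrices; the eigenvalue [d k] is the
    value of the form at the [k]-th row of [P], hence nonnegative. *)
Lemma psd_spectral L : psd L -> exists (d : 'I_m -> R[i]) (P : 'I_m -> 'I_m -> R[i]),
  (forall k, 0 <= d k) /\ forall i j, L i j = \sum_k d k * ((P k i)^* * P k j).
Proof.
move=> [Lh L0]; pose M : 'M[R[i]]_m := \matrix_(i, j) L i j.
have Mn : M \is normalmx.
  apply: hermitian_normalmx; apply/sesquiP; rewrite expr0 scale1r.
  by apply/matrixP => i j; rewrite !mxE; exact: Lh.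
have /orthomx_spectralP ME := Mn.
set P := spectralmx M in ME; set D := spectral_diag M in ME.
have Pu : P \is unitarymx by exact: spectral_unitarymx.
rewrite (invmx_unitary Pu) in ME.
exists (fun k => D 0 k), (fun k i => P k i); split=> [k|i j]; last first.
  have -> : L i j = M i j by rewrite mxE.
  rewrite ME -mulmxA mul_diag_mx mxE; apply: eq_bigr => k _.
  by rewrite !mxE; ring.
have DE : diag_mx D = P *m M *m P ^t*.
  have PP : P *m P ^t* = 1%:M by apply/unitarymxP.
  by rewrite ME !mulmxA PP mul1mx -mulmxA PP mulmx1.
have -> : D 0 k = diag_mx D k k by rewrite mxE eqxx mulr1n.
suff -> : diag_mx D k k = form_sum L (fun i => P k i) by exact: L0.
rewrite DE mxE /form_sum exchange_big; apply: eq_bigr => j _ /=.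
rewrite mxE mulr_suml; apply: eq_bigr => i _; rewrite !mxE; ring.
Qed.

(** Each rank-one summand of [L] is absorbed into the coefficients, so that the form of the
    entrywise product is a combination of values of the form of [K] with weights [d k >= 0]. *)
Lemma psd_schur K L : psd K -> psd L -> psd (fun i j => K i j * L i j).
Proof.
move=> [Kh K0] Lp; have [Lh _] := Lp.
split=> [i j|a]; first by rewrite Kh Lh rmorphM.
have [d [P [d0 LE]]] := psd_spectral Lp.
suff -> : form_sum (fun i j => K i j * L i j) a =
    \sum_k d k * form_sum K (fun i => a i * (P k i)^*).
  by apply: sumr_ge0 => k _; rewrite mulr_ge0.
rewrite /form_sum; under [RHS]eq_bigr => k _ do rewrite mulr_sumr.
rewrite [RHS]exchange_big; apply: eq_bigr => i _ /=.
under [RHS]eq_bigr => k _ do rewrite mulr_sumr.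
rewrite [RHS]exchange_big; apply: eq_bigr => j _ /=.
rewrite LE !mulr_sumr; apply: eq_bigr => k _.
by rewrite rmorphM /= conjCK; ring.
Qed.

(** The form is the sum, over the classes, of the squared modulus of the sum of the coefficients in
    the class. *)
Lemma psd_equivalence (e : 'I_m -> 'I_m -> Prop) :
  (forall i, e i i) -> (forall i j, e i j -> e j i) ->
  (forall i j k, e i j -> e j k -> e i k) ->
  psd (fun i j => if `[< e i j >] then 1 else 0).
Proof.
move=> er es et; split=> [i j|a].
  have -> : `[< e j i >] = `[< e i j >] by apply/asboolP/asboolP; exact: es.
  by case: ifP; rewrite ?rmorph1 ?rmorph0.
pose r i := odflt i [pick j | `[< e i j >]].
have rP i j : `[< e i j >] = (r i == r j).
  apply/asboolP/eqP => [ij|].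
    rewrite /r (@eq_pick _ _ (fun k => `[< e j k >])).
      by case: pickP => // /(_ j); rewrite asboolT.
    by move=> k; apply/asboolP/asboolP; apply: et => //; exact: es.
  rewrite /r; case: pickP => [k /asboolP ik|/(_ i)]; last by rewrite asboolT.
  case: pickP => [l /asboolP jl|/(_ j)]; last by rewrite asboolT.
  by move=> /= kl; apply: et ik _; rewrite kl; exact: es.
suff -> : form_sum (fun i j => if `[< e i j >] then 1 else 0) a =
    \sum_k `|\sum_(i | r i == k) a i| ^+ 2 by apply: sumr_ge0 => k _; rewrite exprn_ge0.
rewrite /form_sum (partition_big r xpredT) //=; apply: eq_bigr => k _.
rewrite normCK rmorph_sum /= mulr_suml; apply: eq_bigr => i /eqP rik.
rewrite mulr_sumr [RHS]big_mkcond; apply: eq_bigr => j _ /=.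
by rewrite rP rik eq_sym; case: ifP; rewrite ?mulr1 ?mulr0.
Qed.

(** Telescoping: with [P], [P'] the products of the first [N] factors, [P K_N - P' K'_N = (P - P')
    K_N + P' (K_N - K'_N)]. The first conclusion is carried along for the second summand. *)
Lemma psd_prod_le (K K' : nat -> 'I_m -> 'I_m -> R[i]) E N :
  psd E -> (forall n, psd (K' n)) -> (forall n, psd (fun i j => K n i j - K' n i j)) ->
  psd (fun i j => E i j * \prod_(n < N) K' n i j) /\
  psd (fun i j => E i j * (\prod_(n < N) K n i j - \prod_(n < N) K' n i j)).
Proof.
move=> Ep K'p Dp.
have Kp n : psd (K n).
  have -> : K n = (fun i j => (K n i j - K' n i j) + K' n i j).
    by apply/funext => i; apply/funext => j; rewrite subrK.
  exact: psdD.
elim: N => [|N [IH1 IH2]]; split.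
- have -> : (fun i j => E i j * \prod_(n < 0) K' n i j) = E; last by [].
  by apply/funext => i; apply/funext => j; rewrite big_ord0 mulr1.
- split=> [i j|a]; first by rewrite !big_ord0 subrr !mulr0 rmorph0.
  rewrite /form_sum big1 // => i _; rewrite big1 // => j _.
  by rewrite !big_ord0 subrr !mulr0.
- have -> : (fun i j => E i j * \prod_(n < N.+1) K' n i j) =
    (fun i j => (E i j * \prod_(n < N) K' n i j) * K' N i j).
    by apply/funext => i; apply/funext => j; rewrite big_ord_recr mulrA.
  exact: psd_schur.
have -> : (fun i j => E i j * (\prod_(n < N.+1) K n i j - \prod_(n < N.+1) K' n i j)) =
    (fun i j => (E i j * (\prod_(n < N) K n i j - \prod_(n < N) K' n i j)) * K N i j +
      (E i j * \prod_(n < N) K' n i j) * (K N i j - K' N i j)).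
  by apply/funext => i; apply/funext => j; rewrite !big_ord_recr /=; ring.
by apply: psdD; apply: psd_schur.
Qed.

Lemma cvg_form_sum (K : nat -> 'I_m -> 'I_m -> R[i]) (L : 'I_m -> 'I_m -> R[i]) a :
  (forall i j, (K N i j : R[i]^o) @[N --> \oo] --> (L i j : R[i]^o)) ->
  (form_sum (K N) a : R[i]^o) @[N --> \oo] --> (form_sum L a : R[i]^o).
Proof.
move=> KL.
apply: (@cvg_csum _ _ _ (fun N i => \sum_j a i * (a j)^* * K N i j)) => i.
apply: (@cvg_csum _ _ _ (fun N j => a i * (a j)^* * K N i j)) => j.
exact: (cvg_cmul (cvg_cst (a i * (a j)^* : R[i]^o)) (KL i j)).
Qed.

End schur.

Section gram.
Context {R : realType}.

Lemma inner_suml (V : hilbertType R) I (s : seq I) (u : I -> V) v :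
  inner (\sum_(i <- s) u i) v = \sum_(i <- s) inner (u i) v.
Proof. by elim/big_rec2: _ => [|i x y _ <-]; rewrite ?inner0l ?innerDl. Qed.

Lemma inner_sumr (V : hilbertType R) I (s : seq I) (u : I -> V) v :
  inner v (\sum_(i <- s) u i) = \sum_(i <- s) inner v (u i).
Proof. by elim/big_rec2: _ => [|i x y _ <-]; rewrite ?inner0r ?innerDr. Qed.

Lemma inner_form_sum (V : hilbertType R) m (u : 'I_m -> V) (a : 'I_m -> R[i]) :
  (rnorm (\sum_i a i *: u i) ^+ 2)%:C%C = form_sum (fun i j => inner (u i) (u j)) a.
Proof.
rewrite -inner_rnorm inner_suml; apply: eq_bigr => i _.
rewrite inner_sumr; apply: eq_bigr => j _.
by rewrite innerZl innerZr mulrA.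
Qed.

Lemma cvg_Re_ge0 (f : nat -> R[i]^o) (l : R[i]^o) : f @ \oo --> l ->
  (forall N, 0 <= f N) -> 0 <= complex.Re l.
Proof.
move=> /cvg_rnormP fl f0; apply/ler_addgt0Pr => e e0.
have [N _ /(_ N (leqnn N)) /= Nl] := fl e e0.
have := rnorm_Re (f N - l); rewrite ReB ler_norml => /andP[_].
have := f0 N; rewrite lecE /= => /andP[_]; lra.
Qed.

Context {H : nat -> hilbertType R} (T : complete_tensor H).
Variables (A : forall n, {linear H n -> H n}) (c : nat -> R).
Hypotheses (c0 : forall n, 0 <= c n) (cs : near1 (fun n => (c n)%:C%C : R[i])).
Hypothesis Ac : forall n u, rnorm (A n u) ^+ 2 <= c n * rnorm u ^+ 2.

(** The form is [q_n] evaluated at the combination of the [u i]. *)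
Lemma psd_defect n m (u : 'I_m -> H n) :
  psd (fun i j => (c n)%:C%C * inner (u i) (u j) - inner (A n (u i)) (A n (u j))).
Proof.
split=> [i j|a].
  rewrite rmorphB rmorphM /= -!innerC; congr (_ * _ - _).
  exact/esym/conjc_real.
have -> : form_sum (fun i j =>
      (c n)%:C%C * inner (u i) (u j) - inner (A n (u i)) (A n (u j))) a =
    (c n * rnorm (\sum_i a i *: u i) ^+ 2 - rnorm (A n (\sum_i a i *: u i)) ^+ 2)%:C%C.
  rewrite rmorphB rmorphM /= linear_sum.
  have -> : \sum_i A n (a i *: u i) = \sum_i a i *: A n (u i).
    by apply: eq_bigr => i _; rewrite linearZ.
  rewrite !inner_form_sum /form_sum mulr_sumr -sumrB; apply: eq_bigr => i _.
  by rewrite mulr_sumr -sumrB; apply: eq_bigr => j _; ring.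
by rewrite ler0c subr_ge0.
Qed.

Lemma psd_gram n m (u : 'I_m -> H n) : psd (fun i j => inner (u i) (u j)).
Proof.
split=> [i j|a]; first by rewrite -innerC.
by rewrite -inner_form_sum ler0c sqr_ge0.
Qed.

Definition prod_bound : R := complex.Re (qprod (fun n => (c n)%:C%C)).

Lemma prod_boundE : qprod (fun n => (c n)%:C%C) = prod_bound%:C%C :> R[i].
Proof.
have bid : bijective (@id nat) by exists id.
have /cvg_rnormP zc := near1_uncond cs bid.
rewrite RRe_real //; apply/complex_realP; exists prod_bound.
rewrite [LHS]complexE; suff -> : complex.Im (qprod (fun n => (c n)%:C%C)) = 0 :> R.
  by rewrite mulr0 addr0.
apply/eqP; rewrite -normr_le0; apply/ler_addgt0Pr => e e0; rewrite add0r.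
have [N _ /(_ N (leqnn N)) /= Ne] := zc e e0.
rewrite -normrN; apply: le_trans (ltW Ne); apply: le_trans (rnorm_Im _).
rewrite -rmorph_prod /=.
by case: (qprod _) => x y /=; rewrite add0r.
Qed.

(* The factor [h i ~ h j] selects the pairs for which the product of the inner
   products converges to its quasi-value; it is positive semidefinite, so the
   Schur product theorem still applies after multiplying by it. *)
Lemma gram_le m (h : 'I_m -> forall n, H n) (a : 'I_m -> R[i]) :
  (forall i, is_Cseq (h i)) ->
  rnorm (\sum_i a i *: tens T (app_seq A (h i))) ^+ 2 <=
  prod_bound * rnorm (\sum_i a i *: tens T (h i)) ^+ 2.
Proof.
move=> hC; pose e i j := tensor_rel (h i) (h j).
have Ep : psd (fun i j => if `[< e i j >] then 1 else 0 : R[i]).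
  apply: psd_equivalence => [i|i j|i j k]; first by left.
    exact: tensor_rel_sym.
  exact: tensor_rel_trans.
pose K n i j := (c n)%:C%C * inner (h i n) (h j n).
pose K' n i j := inner (app_seq A (h i) n) (app_seq A (h j) n).
have KN N := (psd_prod_le (K := K) (K' := K') N Ep (fun n => psd_gram _)
  (fun n => psd_defect _)).2.2 a.
(* For an unrelated pair both quasi-values vanish, which agrees with the zero entry of the mask. *)
pose L i j := qprod (fun n => (c n)%:C%C) * qprod (fun n => inner (h i n) (h j n)) -
  qprod (fun n => inner (app_seq A (h i) n) (app_seq A (h j) n)).
suff KL i j : ((if `[< e i j >] then 1 else 0) *
    (\prod_(n < N) K n i j - \prod_(n < N) K' n i j) : R[i]^o) @[N --> \oo] -->
    (L i j : R[i]^o).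
  have := cvg_Re_ge0 (cvg_form_sum (a := a) KL) KN.
  have -> : form_sum L a = (prod_bound * rnorm (\sum_i a i *: tens T (h i)) ^+ 2 -
      rnorm (\sum_i a i *: tens T (app_seq A (h i))) ^+ 2)%:C%C.
    rewrite rmorphB rmorphM /= !inner_form_sum /form_sum mulr_sumr -sumrB.
    apply: eq_bigr => i _; rewrite mulr_sumr -sumrB; apply: eq_bigr => j _.
    rewrite !ct_inner //; try exact: (app_Cseq c0 cs Ac).
    by rewrite /L prod_boundE; ring.
  by rewrite subr_ge0.
have bid : bijective (@id nat) by exists id.
case: asboolP => [eij|neij].
  have k1 := uncond_prodM (near1_uncond cs) (inner_rel (hC i) (hC j) eij) bid.
  have k2 := app_inner_rel c0 cs Ac (hC i) (hC j) eij bid.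
  under eq_fun do rewrite mul1r.
  exact: (@cvgB R[i] R[i]^o _ _ _ _ _ _ _ k1 k2).
rewrite /L (inner_unrel (hC i) (hC j) neij).
rewrite (app_inner_unrel c0 cs Ac (hC i) (hC j) neij) mulr0 subr0.
by under eq_fun do rewrite mul0r; exact: cvg_cst.
Qed.

End gram.

(** * Bounded operators on closed spans *)

Section spans.
Context {K : pzRingType} {V : lmodType K}.
Implicit Types (S : set V).

Lemma lin_span_gen S x : S x -> lin_span S x.
Proof.
move=> Sx; exists 1%N, (fun=> 1), (fun=> x); split=> //.
by rewrite big_ord1 scale1r.
Qed.

Lemma lin_span_lin S a x y :
  lin_span S x -> lin_span S y -> lin_span S (a *: x + y).
Proof.
move=> [m [b [v [Sv ->]]]] [m' [b' [v' [Sv' ->]]]].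
exists (m + m')%N, (fun i => match fintype.split i with inl j => a * b j | inr k => b' k end).
exists (fun i => match fintype.split i with inl j => v j | inr k => v' k end); split.
  by move=> i; case: splitP.
rewrite big_split_ord /= scaler_sumr; congr (_ + _); apply: eq_bigr => i _.
  by rewrite -[lshift _ _]/(unsplit (inl i)) unsplitK scalerA.
by rewrite -[rshift _ _]/(unsplit (inr i)) unsplitK.
Qed.

End spans.

Section closed_span.
Context {R : realType} {V : hilbertType R}.
Implicit Types (S W : set V) (B : V -> V).

Lemma lincomb_dist (a : R[i]) (u u' s s' : V) (e : R) :
  rnorm (u - s) < e / (rnorm a + 1) / 2 -> rnorm (u' - s') < e / 2 ->
  rnorm (a *: u + u' - (a *: s + s')) < e.
Proof.
move=> h1 h2; have -> : a *: u + u' - (a *: s + s') = a *: (u - s) + (u' - s').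
  by rewrite opprD addrACA scalerBr.
have a1 : 0 < rnorm a + 1 by have := rnorm_ge0 a; lra.
apply: (le_lt_trans (rnormD _ _)); rewrite rnormZ.
have : rnorm a * rnorm (u - s) <= (rnorm a + 1) * (e / (rnorm a + 1) / 2).
  by apply: ler_pM; rewrite ?rnorm_ge0 //; [lra|exact: ltW].
rewrite [e / _ / 2]mulrAC mulrCA divff ?gt_eqF // mulr1; lra.
Qed.

Lemma closure_lin S a x y : closure (lin_span S) x -> closure (lin_span S) y ->
  closure (lin_span S) (a *: x + y).
Proof.
move=> /closure_rnormP xS /closure_rnormP yS; apply/closure_rnormP => e e0.
have a1 : 0 < rnorm a + 1 by have := rnorm_ge0 a; lra.
have [u Su xu] := xS (e / (rnorm a + 1) / 2) ltac:(by rewrite !divr_gt0).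
have [v Sv yv] := yS (e / 2) ltac:(by rewrite divr_gt0).
by exists (a *: u + v); [exact: lin_span_lin|exact: lincomb_dist].
Qed.

Lemma closure_lin0 S : closure (lin_span S) 0.
Proof.
apply: subset_closure; exists 0%N, (fun=> 0), (fun=> 0); split=> [[]//|].
by rewrite big_ord0.
Qed.

Lemma closure_linZ S a x : closure (lin_span S) x -> closure (lin_span S) (a *: x).
Proof.
by move=> Sx; rewrite -[a *: x]addr0; apply: closure_lin => //; exact: closure_lin0.
Qed.

Lemma closure_linB S x y : closure (lin_span S) x -> closure (lin_span S) y ->
  closure (lin_span S) (x - y).
Proof. by move=> Sx Sy; rewrite addrC -scaleN1r; exact: closure_lin. Qed.

Lemma closure_gen S x : S x -> closure (lin_span S) x.
Proof. by move=> Sx; apply/subset_closure/lin_span_gen. Qed.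

(** The constant in [bounded_op_on] is complex, but [M |x|] dominates a norm and therefore equals
    its own modulus. *)
Lemma bounded_op_bound W B : bounded_op_on W B ->
  exists2 M : R, 0 <= M & forall x, W x -> rnorm (B x) <= M * rnorm x.
Proof.
move=> [_ _ [M BM]]; exists (rnorm M); first exact: rnorm_ge0.
move=> x /BM; rewrite -lecR -rnormE => h; apply: (le_trans h).
have : 0 <= M * `|x| by apply: le_trans h.
by move=> /ger0_norm <-; rewrite normrM normr_id rmorphM /= -!rnormE.
Qed.

Lemma bounded_op_intro W B (M : R) :
  (forall x, W x -> W (B x)) ->
  (forall a x x', W x -> W x' -> B (a *: x + x') = a *: B x + B x') ->
  (forall x, W x -> rnorm (B x) <= M * rnorm x) -> bounded_op_on W B.
Proof.
move=> BW Bl BM; split=> //; exists M%:C%C => x /BM.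
by rewrite !rnormE -rmorphM /= lecR.
Qed.

Section on_span.
Variable S : set V.
Let W := closure (lin_span S).

Lemma bounded_op_sub B x y : bounded_op_on W B -> W x -> W y -> B (x - y) = B x - B y.
Proof.
by move=> [_ Bl _] Wx Wy; rewrite addrC -scaleN1r Bl // scaleN1r addrC.
Qed.

Lemma bounded_op0 B : bounded_op_on W B -> B 0 = 0.
Proof.
by move=> Bb; rewrite -[in LHS](subrr 0) (bounded_op_sub Bb) ?subrr //;
  exact: closure_lin0.
Qed.

Lemma bounded_op_sum B m (a : 'I_m -> R[i]) (v : 'I_m -> V) :
  bounded_op_on W B -> (forall i, S (v i)) ->
  B (\sum_i a i *: v i) = \sum_i a i *: B (v i).
Proof.
move=> Bb Sv; have [_ Bl _] := Bb.
suff [] : W (\sum_i a i *: v i) /\ B (\sum_i a i *: v i) = \sum_i a i *: B (v i) by [].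
apply: (big_rec2 (fun x y => W x /\ B x = y)) => [|i y1 y2 _ [Wy <-]].
  by split; [exact: closure_lin0|exact: bounded_op0].
by split; [apply: closure_lin => //|rewrite Bl //]; exact: closure_gen.
Qed.

Lemma bounded_op_eq B1 B2 : bounded_op_on W B1 -> bounded_op_on W B2 ->
  (forall x, S x -> B1 x = B2 x) -> forall x, W x -> B1 x = B2 x.
Proof.
move=> b1 b2 B12 x Wx; apply/eqP; rewrite -subr_eq0 -rnorm_eq0 -normr_le0.
rewrite ger0_norm ?rnorm_ge0 //; apply/ler_addgt0Pr => e e0; rewrite add0r.
have [M1 M10 BM1] := bounded_op_bound b1; have [M2 M20 BM2] := bounded_op_bound b2.
have M0 : 0 < M1 + M2 + 1 by lra.
have /closure_rnormP/(_ (e / (M1 + M2 + 1)))[|s Ss xs] := Wx; first exact: divr_gt0.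
have Ws : W s by exact: subset_closure.
have Bs : B1 s = B2 s.
  have [m [a [v [Sv ->]]]] := Ss; rewrite !bounded_op_sum //.
  by apply: eq_bigr => i _; rewrite B12.
have -> : B1 x - B2 x = B1 (x - s) - B2 (x - s).
  rewrite (bounded_op_sub b1) // (bounded_op_sub b2) // Bs.
  by rewrite opprB addrA subrK.
apply: le_trans (rnormB _ _) _; have Wxs := closure_linB Wx Ws.
have := BM1 _ Wxs; have := BM2 _ Wxs; rewrite ltr_pdivlMr // in xs.
have := rnorm_ge0 (x - s); nra.
Qed.

Lemma bounded_op_nonzero B : bounded_op_on W B -> nonzero_on W B ->
  exists2 x, S x & B x != 0.
Proof.
move=> Bb [x Wx Bx]; apply: contrapT => nS; move: Bx; apply/negP; rewrite negbK.
apply/eqP; apply: (@bounded_op_eq _ (fun=> 0)) Wx => //.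
  apply: (@bounded_op_intro _ _ 0) => [*|*|y _]; first exact: closure_lin0.
    by rewrite scaler0 addr0.
  by rewrite rnorm0 mul0r.
move=> y Sy; apply/eqP; apply: contrapT => /negP By; apply: nS; exists y => //.
Qed.

Lemma bounded_op_invariant B : bounded_op_on setT B ->
  (forall x, S x -> W (B x)) -> forall x, W x -> W (B x).
Proof.
move=> Bb BS x Wx; have [M M0 BM] := bounded_op_bound Bb; have [_ Bl _] := Bb.
have B0 : B 0 = 0.
  have := Bl (-1) 0 0 I I; rewrite scaler0 addr0 scaleN1r addrC subrr. by [].
have -> : W (B x) = closure W (B x).
  by rewrite -(closure_id W).1 //; exact: closed_closure.
apply/closure_rnormP => e e0.
have M1 : 0 < M + 1 by lra.
have /closure_rnormP/(_ (e / (M + 1)))[|s Ss xs] := Wx; first exact: divr_gt0.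
exists (B s).
  have [m [a [v [Sv ->]]]] := Ss.
  elim/big_rec: _ => [|i y _ Wy]; first by rewrite B0; exact: closure_lin0.
  by rewrite Bl //; apply: closure_lin => //; exact: BS.
have -> : B x - B s = B (x - s).
  have -> : x - s = (-1) *: s + x by rewrite scaleN1r addrC.
  by rewrite Bl // scaleN1r addrC.
apply: le_lt_trans (BM _ I) _; rewrite ltr_pdivlMr // in xs.
have := rnorm_ge0 (x - s); nra.
Qed.

(** For [s] in the span, [|x|^2 = <x, x - s> <= |x| |x - s|], and [s] may be taken arbitrarily close
    to [x]. *)
Lemma closed_span_orthogonal x : W x -> (forall s, S s -> inner x s = 0) -> x = 0.
Proof.
move=> Wx xS; apply/eqP; rewrite -rnorm_eq0 -normr_le0 ger0_norm ?rnorm_ge0 //.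
apply/ler_addgt0Pr => e e0; rewrite add0r.
have [->|x0] := eqVneq x 0; first by rewrite rnorm0 ltW.
have /closure_rnormP/(_ e e0)[s [m [a [v [Sv sE]]]] xs] := Wx.
have xs0 : inner x s = 0.
  by rewrite sE inner_sumr big1 // => i _; rewrite innerZr xS ?mulr0.
have : (rnorm x ^+ 2)%:C%C = inner x (x - s).
  by rewrite innerBr xs0 subr0 inner_rnorm.
move=> /(congr1 (@rnorm _ _)); rewrite rnormR ger0_norm ?sqr_ge0 // => h.
have := inner_CauchySchwarz x (x - s); rewrite -h expr2 ler_pM2l ?rnorm_gt0 //.
by move=> k; apply: le_trans k (ltW xs).
Qed.

End on_span.

(** * Bounded extension of a map prescribed on a spanning family *)

Section extension.
Variables (I : Type) (v w : I -> V) (M : R).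
Hypothesis M0 : 0 <= M.
Hypothesis vw : forall m (a : 'I_m -> R[i]) (s : 'I_m -> I),
  rnorm (\sum_k a k *: w (s k)) <= M * rnorm (\sum_k a k *: v (s k)).
Hypothesis v_dense : closure (lin_span (range v)) = setT.

(** The [v k] may be linearly dependent, so the linear extension is built as a relation, the span of
    the graph in [V * V]; the estimate [vw] makes it single-valued. *)
Let G := lin_span (range (fun k => (v k, w k) : (V * V)%type)).

Let GM p : G p -> rnorm p.2 <= M * rnorm p.1.
Proof.
move=> [m [a [u [Gu ->]]]].
have /choice[s su] k : exists i, u k = (v i, w i) by have [i _ <-] := Gu k; exists i.
have -> : (\sum_k a k *: u k).2 = \sum_k a k *: w (s k).
  by rewrite raddf_sum; apply: eq_bigr => k _; rewrite su.
have -> : (\sum_k a k *: u k).1 = \sum_k a k *: v (s k).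
  by rewrite raddf_sum; apply: eq_bigr => k _; rewrite su.
exact: vw.
Qed.

(** The closure of [G], which is the graph of the extended operator. *)
Let P x y := forall e, 0 < e ->
  exists p : V * V, [/\ G p, rnorm (x - p.1) < e & rnorm (y - p.2) < e].

Let P_lin a x y x' y' : P x y -> P x' y' -> P (a *: x + x') (a *: y + y').
Proof.
move=> Pxy Pxy' e e0; have a1 : 0 < rnorm a + 1 by have := rnorm_ge0 a; lra.
have [p [Gp p1 p2]] := Pxy (e / (rnorm a + 1) / 2) ltac:(by rewrite !divr_gt0).
have [q [Gq q1 q2]] := Pxy' (e / 2) ltac:(by rewrite divr_gt0).
by exists (a *: p + q); split; [exact: lin_span_lin|exact: lincomb_dist|exact: lincomb_dist].
Qed.

Let P_bound x y : P x y -> rnorm y <= M * rnorm x.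
Proof.
move=> Pxy; apply/ler_addgt0Pr => e e0; have M1 : 0 < M + 1 by rewrite ltr_wpDl.
have [p [/GM Gp p1 p2]] := Pxy (e / (M + 1)) ltac:(by rewrite divr_gt0).
have : (M + 1) * (e / (M + 1)) = e by rewrite mulrCA divff ?gt_eqF ?mulr1.
move: (e / (M + 1)) p1 p2 => d p1 p2 dE.
have h1 := rnorm_sub_le y p.2; have := rnorm_sub_le p.1 x; rewrite (rdistC p.1) => h2.
have : M * rnorm p.1 <= M * (rnorm x + d) by rewrite ler_wpM2l //; lra.
lra.
Qed.

Let P_ex x : exists y, P x y.
Proof.
have /choice[p pP] (n : nat) : exists p : V * V, G p /\ rnorm (x - p.1) < n.+1%:R^-1.
  have : closure (lin_span (range v)) x by rewrite v_dense.
  move=> /closure_rnormP/(_ n.+1%:R^-1)[|s [m [a [u [vu ->]]]] xs].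
    by rewrite invr_gt0.
  have /choice[t tu] k : exists i, u k = v i by have [i _ <-] := vu k; exists i.
  exists (\sum_k a k *: (v (t k), w (t k))); split.
    by exists m, a, (fun k => (v (t k), w (t k))); split=> // k; exists (t k).
  rewrite raddf_sum /=; move: xs; congr (rnorm (x - _) < _).
  by apply: eq_bigr => k _; rewrite tu.
(* First components within [e / (2 M + 1)] of [x] have second components within [e] of one
   another. *)
have M1 : 0 < 2 * M + 1 by rewrite ltr_wpDl ?mulr_ge0.
have small e : 0 < e -> exists N, forall n, (N <= n)%N -> rnorm (x - (p n).1) < e.
  move=> e0; have [N Ne] : exists N : nat, N.+1%:R^-1 < e.
    have /cvgrPdist_lt/(_ e e0)[N _ /(_ N (leqnn N))] := @cvg_harmonic R.
    by rewrite /= sub0r normrN ger0_norm ?invr_ge0 // => h; exists N.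
  exists N => n Nn; apply: lt_trans (pP n).2 _; apply: le_lt_trans Ne.
  by rewrite lef_pV2 ?posrE // ler_nat.
have [|y yl] := @hilbert_cauchy _ _ _ \oo _ (fun n => (p n).2).
  move=> e e0; have [N Ns] := small _ (divr_gt0 e0 M1).
  exists (p N).2; exists N => // n /= Nn.
  have : rnorm ((-1) *: p N + p n).2 <= M * rnorm ((-1) *: p N + p n).1.
    by apply: GM; apply: lin_span_lin; [exact: (pP N).1|exact: (pP n).1].
  rewrite /= !scaleN1r addrC [- (p N).1 + _]addrC => h.
  have := rdistD x (p n).1 (p N).1; rewrite (rdistC _ x) => /(ler_wpM2l M0) h2.
  have := Ns N (leqnn N); have := Ns n Nn; rewrite !ltr_pdivlMr // => h3 h4.
  have := rnorm_ge0 (x - (p n).1); have := rnorm_ge0 (x - (p N).1); lra.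
exists y => e e0; have [N Ns] := small e e0.
have /cvg_rnormP/(_ e e0)[N' _ Ns'] := yl.
exists (p (maxn N N')); split; first exact: (pP _).1.
  by apply: Ns; exact: leq_maxl.
by rewrite rdistC; apply: Ns'; rewrite /= leq_maxr.
Qed.

Lemma dense_extension : exists B : V -> V,
  [/\ forall a x x', B (a *: x + x') = a *: B x + B x',
      forall x, rnorm (B x) <= M * rnorm x & forall i, B (v i) = w i].
Proof.
have [B BP] := choice P_ex; exists B.
have P_uniq x y : P x y -> B x = y.
  move=> Pxy; have := P_bound (P_lin (-1) Pxy (BP x)).
  rewrite !scaleN1r addNr rnorm0 mulr0 => h; apply/eqP.
  rewrite -subr_eq0 addrC -rnorm_eq0; apply/eqP/le_anti.
  by rewrite h rnorm_ge0.
split=> [a x x'|x|i]; apply: P_uniq || idtac.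
- exact: P_lin.
- exact: P_bound.
move=> e e0; exists (v i, w i); rewrite /= !subrr !rnorm0; split=> //.
by apply: lin_span_gen; exists i.
Qed.

End extension.

End closed_span.

Section opnorms.
Context {R : realType}.

Lemma opnorm_ub (V : hilbertType R) (W : set V) (B : V -> V) : bounded_op_on W B ->
  has_ubound [set complex.Re `|B x| | x in [set x | W x /\ `|x| <= 1]].
Proof.
move=> /bounded_op_bound[M M0 BM]; exists M => _ [x [Wx x1] <-].
apply: le_trans (BM x Wx) _; rewrite ler_piMr //.
by rewrite -lecR -rnormE.
Qed.

Lemma le_opnorm (V : hilbertType R) (S : set V) (B : V -> V) x :
  let W := closure (lin_span S) in
  bounded_op_on W B -> W x -> rnorm (B x) <= opnorm W B * rnorm x.
Proof.
move=> W Bb Wx; have [->|x0] := eqVneq x 0.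
  by rewrite (bounded_op0 Bb) !rnorm0 mulr0.
have nx : 0 < rnorm x by rewrite rnorm_gt0.
pose u := ((rnorm x)^-1)%:C%C *: x.
have Wu : W u by exact: closure_linZ.
have u1 : rnorm u = 1.
  by rewrite rnormZ rnormR gtr0_norm ?invr_gt0 // mulVf ?gt_eqF.
have BuE : B u = ((rnorm x)^-1)%:C%C *: B x.
  have [_ Bl _] := Bb; have := Bl ((rnorm x)^-1)%:C%C x 0 Wx (closure_lin0 _).
  by rewrite (bounded_op0 Bb) !addr0.
have : rnorm (B u) <= opnorm W B.
  apply: (ub_le_sup (opnorm_ub Bb)); exists u => //; split=> //.
  by rewrite rnormE u1.
by rewrite BuE rnormZ rnormR gtr0_norm ?invr_gt0 // ler_pdivrMl // mulrC.
Qed.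

Lemma opnorm_le (V : hilbertType R) (W : set V) (B : V -> V) M : W 0 -> 0 <= M ->
  (forall x, W x -> rnorm (B x) <= M * rnorm x) -> opnorm W B <= M.
Proof.
move=> W0 M0 BM; apply: ge_sup.
  by exists (complex.Re `|B 0|), 0 => //; split=> //; rewrite normr0.
move=> _ [x [Wx x1] <-]; apply: le_trans (BM x Wx) _; rewrite ler_piMr //.
by rewrite -lecR -rnormE.
Qed.

Lemma setT_span (V : hilbertType R) : closure (lin_span [set: V]) = setT.
Proof. by rewrite -subTset => x _; exact: closure_gen. Qed.

Lemma continuous_bounded_op (V : hilbertType R) (A : {linear V -> V}) :
  continuous A -> bounded_op_on setT A.
Proof.
move=> /(_ 0)/cvg_rnormP/(_ 1 ltr01); rewrite linear0 => /nbhs_normP[d /= d0 dA].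
have dE : d = (complex.Re d)%:C%C by rewrite RRe_real ?gtr0_real.
rewrite dE ltcR in d0; set r := complex.Re d in dE d0.
apply: (@bounded_op_intro _ _ _ _ (2 / r)) => // [a x x' _ _|x _].
  by rewrite linearP.
have [->|x0] := eqVneq x 0; first by rewrite linear0 !rnorm0 mulr0.
have nx : 0 < rnorm x by rewrite rnorm_gt0.
pose t := r / (2 * rnorm x); have t0 : 0 < t by rewrite divr_gt0 ?mulr_gt0.
have := dA (t%:C%C *: x); rewrite /= /ball_ /= sub0r normrN rnormE dE ltcR.
rewrite rnormZ rnormR (gtr0_norm t0) => /(_ _)/ltW.
have -> : t * rnorm x = r / 2 by rewrite /t; field; rewrite gt_eqF.
rewrite linearZ /= subr0 rnormZ rnormR (gtr0_norm t0) => h.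
have {}h := h ltac:(lra); rewrite -(ler_pM2l t0); apply: le_trans h _.
have -> // : t * (2 / r * rnorm x) = 1.
by rewrite /t; field; rewrite !gt_eqF.
Qed.

End opnorms.

(** * Tensor products of operators *)

Section tensors.
Context {R : realType} {H : nat -> hilbertType R} (T : complete_tensor H).
Implicit Types (h f g y : forall n, H n).

Lemma tens_inner h f : is_Cseq h -> is_Cseq f ->
  inner (tens T h) (tens T f) = qprod (fun n => inner (h n) (f n)).
Proof. exact: ct_inner. Qed.

Lemma tens_sqr h : is_Cseq h ->
  (rnorm (tens T h) ^+ 2)%:C%C = qprod (fun n => (rnorm (h n) ^+ 2)%:C%C).
Proof.
by move=> hC; rewrite -inner_rnorm tens_inner //; apply: qprod_eq => n; exact: inner_rnorm.
Qed.

Lemma rnorm_tens h : is_C0seq h ->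
  rnorm (tens T h) = rnorm (qprod (fun n => (rnorm (h n))%:C%C)).
Proof.
move=> hs; have := tens_sqr (C0_Cseq hs).
have -> : qprod (fun n => (rnorm (h n) ^+ 2)%:C%C) =
    qprod (fun n => (rnorm (h n))%:C%C) ^+ 2 :> R[i].
  rewrite expr2 -qprodM; try exact/C0seqE.
  by apply: qprod_eq => n; rewrite -rmorphM expr2.
move=> /(congr1 (@rnorm _ _)); rewrite rnormR rnormX ger0_norm ?sqr_ge0 //.
by move=> /eqP; rewrite eqrXn2 ?rnorm_ge0 // => /eqP.
Qed.

Lemma ct_emb_sum m (a : 'I_m -> R[i]) (v : 'I_m -> Cseq H -> R[i]^o) :
  (forall i, elem_tensor_span (v i)) ->
  ct_emb T (\sum_i a i *: v i) = \sum_i a i *: ct_emb T (v i).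
Proof.
move=> vS; have S0 : elem_tensor_span (0 : Cseq H -> R[i]^o).
  by exists 0%N, (fun=> 0), (fun=> 0); split=> [[]//|]; rewrite big_ord0.
suff [] : elem_tensor_span (\sum_i a i *: v i) /\
    ct_emb T (\sum_i a i *: v i) = \sum_i a i *: ct_emb T (v i) by [].
apply: (big_rec2 (fun (x : Cseq H -> R[i]^o) (y : T) =>
  elem_tensor_span x /\ ct_emb T x = y)) => [|i x1 x2 _ [Sx <-]].
  split=> //; have := ct_linear T (-1) S0 S0.
  by rewrite scaler0 addr0 scaleN1r addNr.
by split; [apply: lin_span_lin => //; exact: vS|rewrite ct_linear].
Qed.

Lemma tens_dense : closure (lin_span [set tens T h | h in is_Cseq (H := H)]) = setT.
Proof.
rewrite -(ct_dense T); congr closure; apply/seteqP; split=> x.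
  move=> [m [a [v [vS ->]]]].
  have /choice[h hv] i : exists h, is_Cseq h /\ tens T h = v i.
    by have [h hC hv] := vS i; exists h.
  have eS i : [set elem_tensor h | h in is_Cseq (H := H)] (elem_tensor (h i)).
    by exists (h i) => //; exact: (hv i).1.
  exists (\sum_i a i *: elem_tensor (h i)).
    by exists m, a, (fun i => elem_tensor (h i)).
  rewrite ct_emb_sum => [|i]; last exact: lin_span_gen.
  by apply: eq_bigr => i _; rewrite -(hv i).2.
move=> [Phi [m [a [v [vS ->]]]] <-].
have /choice[h hv] i : exists h, is_Cseq h /\ elem_tensor h = v i.
  by have [h hC hv] := vS i; exists h.
exists m, a, (fun i => tens T (h i)); split.
  by move=> i; exists (h i) => //; exact: (hv i).1.
rewrite ct_emb_sum => [|i]; last exact: lin_span_gen.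
by apply: eq_bigr => i _; rewrite /tens (hv i).2.
Qed.

(** [gram_le] is the estimate that [dense_extension] asks for, with constant the square root of the
    product of the [c n]. *)
Lemma complete_op_ex (A : forall n, {linear H n -> H n}) (c : nat -> R) :
  (forall n, 0 <= c n) -> near1 (fun n => (c n)%:C%C : R[i]) ->
  (forall n u, rnorm (A n u) ^+ 2 <= c n * rnorm u ^+ 2) ->
  exists2 B : T -> T, complete_tensor_op T A B &
    forall x, rnorm (B x) <= Num.sqrt (prod_bound c) * rnorm x.
Proof.
move=> c0 cs Ac.
have [|||B [Bl BM Bv]] := @dense_extension _ T (Cseq H) (fun i => tens T (sval i))
    (fun i => tens T (app_seq A (sval i))) (Num.sqrt (prod_bound c)).
- exact: sqrtr_ge0.
- move=> m a s; have := gram_le T c0 cs Ac a (fun k => svalP (s k)) => h.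
  (* For a negative [prod_bound c] the value of [Num.sqrt] is 0, and [h] by itself forces the
     left-hand norm to vanish. *)
  have [b0|b0] := ltP (prod_bound c) 0.
    rewrite ltr0_sqrtr // mul0r -(@ler_pXn2r _ 2) ?nnegrE ?rnorm_ge0 // expr0n /=.
    by apply: le_trans h _; rewrite nmulr_rle0 // sqr_ge0.
  rewrite -(@ler_pXn2r _ 2) ?nnegrE ?mulr_ge0 ?sqrtr_ge0 ?rnorm_ge0 //=.
  by rewrite exprMn sqr_sqrtr.
- rewrite -tens_dense; congr (closure (lin_span _)); apply/seteqP; split=> x.
    by move=> [[h hC] _ <-]; exists h.
  by move=> [h hC <-]; exists (exist _ h hC).
exists B => //; split; first by apply: bounded_op_intro (fun x _ => BM x) => //.
move=> h hC; split; first exact: (app_Cseq c0 cs Ac).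
exact: (Bv (exist _ h hC)).
Qed.

Definition gens y := [set tens T h | h in [set h | is_C0seq h /\ C0_equiv h y]].

Lemma mem_gens y h : is_C0seq h -> C0_equiv h y -> gens y (tens T h).
Proof. by move=> hs hy; exists h. Qed.

Lemma complete_op_invariant y (A : forall n, {linear H n -> H n}) B :
  complete_tensor_op T A B ->
  (forall h, is_C0seq h -> C0_equiv h y ->
    is_C0seq (app_seq A h) /\ C0_equiv (app_seq A h) y) ->
  bounded_op_on (incomplete_tensor T y) B.
Proof.
move=> [Bb BA] Ay.
have BW : forall x, incomplete_tensor T y x -> incomplete_tensor T y (B x).
  apply: bounded_op_invariant => // _ [h [hs hy] <-].
  rewrite (BA h (C0_Cseq hs)).2; apply: closure_gen.
  by have [? ?] := Ay h hs hy; exact: mem_gens.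
have [M M0 BM] := bounded_op_bound Bb; have [_ Bl _] := Bb.
by apply: (@bounded_op_intro _ _ _ _ M) => // [a x x' _ _|x _]; [exact: Bl|exact: BM].
Qed.

(** * The partial operators and their limits on elementary tensors *)

Section partial.
Variables (A : forall n, {linear H n -> H n}) (c : nat -> R).
Hypotheses (c0 : forall n, 0 <= c n).
Hypothesis Ac : forall n u, rnorm (A n u) ^+ 2 <= c n * rnorm u ^+ 2.

Definition restrict_op (F : {fset nat}) n : {linear H n -> H n} :=
  if n \in F then A n else idfun.

Lemma app_restrict F h : app_seq (restrict_op F) h = app_seq_on A F h.
Proof.
apply: functional_extensionality_dep => n.
by rewrite /app_seq /app_seq_on /restrict_op; case: ifP.
Qed.

Lemma app_seq_on_cofin F h n : n \notin F -> app_seq_on A F h n = h n.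
Proof. by rewrite /app_seq_on => /negbTE ->. Qed.

(** [A_F] is the complete tensor product with identity factors outside [F], so the bound there is 1
    and the product of bounds is finite. *)
Lemma partial_op_ex y F : exists2 B : T -> T, partial_tensor_op T A y F B &
  forall x, rnorm (B x) <= Num.sqrt (\prod_(n <- F) c n) * rnorm x.
Proof.
pose cF n := if n \in F then c n else 1.
have cF0 n : 0 <= cF n by rewrite /cF; case: ifP.
have cFs : near1 (fun n => (cF n)%:C%C : R[i]).
  by apply: (@near1_cofin _ F _ _ _ near1_const1) => n /negbTE nF; rewrite /cF nF.
have cFA n u : rnorm (restrict_op F n u) ^+ 2 <= cF n * rnorm u ^+ 2.
  by rewrite /restrict_op /cF; case: ifP => _; [exact: Ac|rewrite mul1r].
have [B BA BM] := complete_op_ex cF0 cFs cFA; exists B.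
  split.
    apply: (complete_op_invariant BA) => h hs hy; rewrite app_restrict.
    split; first exact: C0_cofin (@app_seq_on_cofin F h) hs.
    exact: C0_equiv_cofin (@app_seq_on_cofin F h) hy.
  move=> h hs hy; rewrite -app_restrict; exact: (BA.2 h (C0_Cseq hs)).2.
suff <- : prod_bound cF = \prod_(n <- F) c n by [].
rewrite /prod_bound; have -> : qprod (fun n => (cF n)%:C%C) =
    qprod (fun n => if n \in F then (c n)%:C%C else 1) :> R[i].
  by apply: qprod_eq => n; rewrite /cF; case: ifP.
by rewrite qprod_finite -rmorph_prod.
Qed.

End partial.

Section limits.
Variables (A : forall n, {linear H n -> H n}).

Lemma inner_app_on F h g n : inner (app_seq_on A F h n) (g n) =
  mix F (fun n => inner (app_seq A h n) (g n)) (fun n => inner (h n) (g n)) n.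
Proof. by rewrite /app_seq_on /mix; case: ifP. Qed.

Lemma app_on_C0 F h : is_C0seq h -> is_C0seq (app_seq_on A F h).
Proof. exact: C0_cofin (@app_seq_on_cofin A F h). Qed.

(** In [|A_F h - A h|^2 = |A_F h|^2 + |A h|^2 - 2 Re <A_F h, A h>], norms being those of the
    tensors, the first term and the inner product are spliced products, both with limit
    [|A h|^2]. *)
Lemma cvg_tens_app h : is_C0seq h -> is_C0seq (app_seq A h) ->
  C0_equiv (app_seq A h) h ->
  tens T (app_seq_on A F h) @[F --> totally] --> tens T (app_seq A h).
Proof.
move=> hs Ahs Ahh.
pose z n : R[i] := (rnorm (app_seq A h n) ^+ 2)%:C%C.
have zs : near1 z by apply/C0seq_sqr.
have w1s : near1 (fun n => (rnorm (h n) ^+ 2)%:C%C : R[i]) by apply/C0seq_sqr.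
have w2s : near1 (fun n => inner (h n) (app_seq A h n)).
  by apply/C0_equivE/C0_equiv_sym.
have /cvg_netP l1 := cvg_qprod_mix zs w1s; have /cvg_netP l2 := cvg_qprod_mix zs w2s.
apply/cvg_netP => e e0.
(* One third for the squared norm, two thirds for the doubled inner product. *)
have e4 : 0 < e ^+ 2 / 3 by rewrite divr_gt0 ?exprn_gt0.
have [F1 F1P] := l1 _ e4; have [F2 F2P] := l2 _ e4.
exists (F1 `|` F2)%fset => F /fsubUsetP[/F1P h1 /F2P h2].
have Fs := app_on_C0 F hs.
have n1 : (rnorm (tens T (app_seq_on A F h)) ^+ 2)%:C%C =
    qprod (mix F z (fun n => (rnorm (h n) ^+ 2)%:C%C)).
  rewrite tens_sqr; last exact: C0_Cseq.
  by apply: qprod_eq => n; rewrite /mix /app_seq_on; case: ifP.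
have n2 : (rnorm (tens T (app_seq A h)) ^+ 2)%:C%C = qprod z.
  by rewrite tens_sqr //; exact: C0_Cseq.
have n3 : inner (tens T (app_seq_on A F h)) (tens T (app_seq A h)) =
    qprod (mix F z (fun n => inner (h n) (app_seq A h n))).
  rewrite tens_inner; try exact: C0_Cseq.
  apply: qprod_eq => n; rewrite inner_app_on /mix; case: ifP => // _.
  exact: inner_rnorm.
rewrite -(@ltr_pXn2r _ 2) ?nnegrE ?rnorm_ge0 ?ltW // rnormB2 n3.
rewrite -n1 -n2 in h1; rewrite -n2 in h2.
have {}h1 := le_lt_trans (rnorm_Re _) h1; have {}h2 := le_lt_trans (rnorm_Re _) h2.
move: h1 h2; rewrite !ReB /= !ltr_norml => /andP[_ h1] /andP[h2 _]; lra.
Qed.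

(** The spliced product is the finite product of [z] times a tail of [w]; the tail tends to 1 and
    can be divided out. This recovers products of [A_n] data from the pairings of [A_F]. *)
Lemma mix_net (z w : nat -> R[i]) (l : R[i]) : near1 w ->
  (qprod (mix F z w) : R[i]^o) @[F --> totally] --> (l : R[i]^o) ->
  netprod z @ totally --> (l : R[i]^o).
Proof.
move=> ws zl; have tl := near1_qprod_tail ws.
have /cvg_netP/(_ _ ltr01)[F0 F0P] := tl.
have tlV : ((qprod (mix F (fun=> 1) w))^-1 : R[i]^o) @[F --> totally] --> (1 : R[i]^o).
  by rewrite -[X in _ --> X]invr1; exact: (@cvgV R[i] _ _ _ _ _ (oner_neq0 _) tl).
have /cvg_netP k : (qprod (mix F z w) * (qprod (mix F (fun=> 1) w))^-1 : R[i]^o)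
    @[F --> totally] --> (l : R[i]^o).
  by rewrite -[l]mulr1; exact: (cvg_cmul zl tlV).
apply/cvg_netP => e e0.
have [F1 F1P] := k e e0; exists (F0 `|` F1)%fset => F /fsubUsetP[/F0P h0 /F1P].
rewrite qprod_mix // mulfK // -rnorm_gt0.
have := rnorm_sub_le 1 (1 - qprod (mix F (fun=> 1) w)).
rewrite subKr rnorm1 rdistC; lra.
Qed.

Lemma cvg_inner (f : {fset nat} -> T) (v u : T) : f @ totally --> v ->
  (inner (f F) u : R[i]^o) @[F --> totally] --> (inner v u : R[i]^o).
Proof.
move=> /cvg_netP fv; apply/cvg_netP => e e0.
have u1 : 0 < rnorm u + 1 by rewrite ltr_wpDl ?rnorm_ge0.
have [F0 F0P] := fv _ (divr_gt0 e0 u1); exists F0 => F /F0P.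
rewrite -innerBl ltr_pdivlMr // => h.
apply: le_lt_trans (inner_CauchySchwarz _ _) _; apply: le_lt_trans h.
by rewrite ler_wpM2l ?rnorm_ge0 // lerDl.
Qed.

Lemma cvg_sqr (f : {fset nat} -> T) (v : T) : f @ totally --> v ->
  ((rnorm (f F) ^+ 2)%:C%C : R[i]^o) @[F --> totally] --> ((rnorm v ^+ 2)%:C%C : R[i]^o).
Proof.
move=> /cvg_netP fv; apply/cvg_netP => e e0.
have v1 : 0 < 2 * rnorm v + 1 by rewrite ltr_wpDl ?mulr_ge0 ?rnorm_ge0.
have d0 : 0 < Num.min 1 (e / (2 * rnorm v + 1)) by rewrite lt_min ltr01 divr_gt0.
have [F0 F0P] := fv _ d0; exists F0 => F /F0P; rewrite lt_min => /andP[h1 h2].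
rewrite -rmorphB rnormR; rewrite ltr_pdivlMr // in h2.
have := rnorm_sub_le (f F) v; have := rnorm_sub_le v (f F); rewrite (rdistC v).
have := rnorm_ge0 v; have := rnorm_ge0 (f F); have := rnorm_ge0 (f F - v).
move: (rnorm (f F - v)) (rnorm (f F)) (rnorm v) h1 h2 => d a b h1 h2 d0' a0 b0 k1 k2.
rewrite subr_sqr normrM (ger0_norm (addr_ge0 a0 b0)).
have : `|a - b| <= d by rewrite ler_norml; apply/andP; split; lra.
have := normr_ge0 (a - b); move: `|a - b| => x x0 xd; nra.
Qed.

End limits.

End tensors.

Section strong_density.
Context {R : realType} {V : hilbertType R}.

Lemma cvg_lincomb (a : R[i]) (f g : {fset nat} -> V) (u v : V) :
  f @ totally --> u -> g @ totally --> v ->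
  a *: f F + g F @[F --> totally] --> a *: u + v.
Proof.
move=> /cvg_netP fu /cvg_netP gv; apply/cvg_netP => e e0.
have a1 : 0 < rnorm a + 1 by have := rnorm_ge0 a; lra.
have [F1 F1P] := fu (e / (rnorm a + 1) / 2) ltac:(by rewrite !divr_gt0).
have [F2 F2P] := gv (e / 2) ltac:(by rewrite divr_gt0).
exists (F1 `|` F2)%fset => F /fsubUsetP[/F1P h1 /F2P h2]; exact: lincomb_dist.
Qed.

(** Approximation by the span under a uniform bound. The bound is asked only from some [F0] on, as
    convergence of the products of the [c n] provides it. *)
Lemma strong_density (S : set V) (Bs : {fset nat} -> V -> V) (B : V -> V) (K : R) :
  let W := closure (lin_span S) in
  (forall F, bounded_op_on W (Bs F)) -> bounded_op_on W B ->
  (exists F0 : {fset nat}, forall F : {fset nat}, (F0 `<=` F)%fset ->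
    forall x, W x -> rnorm (Bs F x) <= K * rnorm x) ->
  (forall x, S x -> Bs F x @[F --> totally] --> B x) ->
  forall x, W x -> Bs F x @[F --> totally] --> B x.
Proof.
move=> W Bsb Bb [F0 BsK] BS x Wx.
have [M M0 BM] := bounded_op_bound Bb.
have spanP s : lin_span S s -> W s /\ Bs F s @[F --> totally] --> B s.
  move=> [m [a [v [Sv ->]]]].
  apply: (big_rec (fun s => W s /\ Bs F s @[F --> totally] --> B s)).
    split; first exact: closure_lin0.
    rewrite (bounded_op0 Bb); under eq_fun do rewrite (bounded_op0 (Bsb _)).
    exact: cvg_cst.
  move=> i t _ [Wt sl]; have Wv : W (v i) by exact: closure_gen.
  split; first exact: closure_lin.
  have [_ -> // _] := Bb.
  have -> : (fun F => Bs F (a i *: v i + t)) = (fun F => a i *: Bs F (v i) + Bs F t).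
    by apply/funext => F; have [_ -> //] := Bsb F.
  exact: (cvg_lincomb (BS _ (Sv i)) sl).
have K1 : 0 < `|K| + M + 1 by rewrite ltr_wpDl ?addr_ge0.
apply/cvg_netP => e e0.
have [|s Ss xs] := (closure_rnormP _ _).1 Wx (e / 2 / (`|K| + M + 1)).
  by rewrite !divr_gt0.
have [Ws /cvg_netP/(_ (e / 2))[|F1 F1P]] := spanP s Ss; first by rewrite divr_gt0.
exists (F0 `|` F1)%fset => F /fsubUsetP[/BsK FK /F1P h1].
have Wxs := closure_linB Wx Ws.
have -> : Bs F x - B x = Bs F (x - s) - B (x - s) + (Bs F s - B s).
  rewrite (bounded_op_sub (Bsb F)) // (bounded_op_sub Bb) //.
  by rewrite opprB addrAC !addrA !subrK.
apply: (le_lt_trans (rnormD _ _)); have := rnormB (Bs F (x - s)) (B (x - s)).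
have := FK _ Wxs; have := BM _ Wxs; rewrite ltr_pdivlMr // in xs.
have := ler_wpM2r (rnorm_ge0 (x - s)) (ler_norm K).
have := rnorm_ge0 (x - s); lra.
Qed.

End strong_density.

Section real_products.
Context {R : realType}.

Lemma uncond_prod_RC (z : nat -> R) (a : R) :
  uncond_prod z a <-> uncond_prod (fun n => (z n)%:C%C) (a%:C%C).
Proof.
split=> za s sb.
  apply/cvg_rnormP => e e0; have /cvgrPdist_lt/(_ e e0) := za s sb.
  by apply: filterS => N /=; rewrite -rmorph_prod -rmorphB rnormR distrC.
apply/cvgrPdist_lt => e e0; have /cvg_rnormP/(_ e e0) := za s sb.
by apply: filterS => N /=; rewrite -rmorph_prod -rmorphB rnormR distrC.
Qed.

Lemma qprod_ge0 (z : nat -> R) : (forall n, 0 <= z n) ->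
  near1 (fun n => (z n)%:C%C : R[i]) ->
  qprod (fun n => (z n)%:C%C) = (rnorm (qprod (fun n => (z n)%:C%C : R[i])))%:C%C.
Proof.
move=> z0 zs; have b : bijective (@id nat) by exists id.
have zc := near1_uncond zs b.
have p0 N : 0 <= \prod_(n < N) (z n)%:C%C :> R[i].
  by apply: prodr_ge0 => n _; rewrite ler0c.
have := cvg_Re_ge0 zc p0; rewrite [qprod _]prod_boundE // => q0.
by rewrite rnormR ger0_norm.
Qed.

(** Turns a bound on products of factors at least 1 into summability of their excess over 1. *)
Lemma sum_le_prod (m : nat -> R) (s : seq nat) : (forall n, 1 <= m n) ->
  \sum_(n <- s) (m n - 1) + 1 <= \prod_(n <- s) m n.
Proof.
move=> m1; elim: s => [|k s IH]; first by rewrite !big_nil add0r.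
rewrite !big_cons; have := m1 k.
have : 0 <= \sum_(n <- s) (m n - 1) by apply: sumr_ge0 => n _; rewrite subr_ge0.
move: IH; set x := \sum_(_ <- _) _; set p := \prod_(_ <- _) _; move: (m k) => r; nra.
Qed.

(** Partial products of factors at least 1 stay at least 1, so the limit in condition (ii) is
    nonzero and convergence is absolute. *)
Lemma near1_max (z : nat -> R) : near1 (fun n => (Num.max 1 (z n))%:C%C : R[i]) <->
  exists a : R, uncond_prod (fun n => Num.max 1 (z n)) a.
Proof.
split=> [zs|[a za]].
  have m0 n : 0 <= Num.max 1 (z n) by rewrite le_max ler01.
  by have := near1_uncond zs; rewrite qprod_ge0 // => /uncond_prod_RC; eexists; eassumption.
apply: (uncond_near1 ((uncond_prod_RC _ _).1 za)).
have b : bijective (@id nat) by exists id.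
apply/eqP => a0; have := za id b; have {a0} -> : a = 0 by case: a0.
move=> /cvgrPdist_lt/(_ 1 ltr01)[N _ /(_ N (leqnn N))] /=.
rewrite sub0r normrN ger0_norm; last first.
  by apply: prodr_ge0 => n _; rewrite le_max ler01.
have := @sum_le_prod (fun n => Num.max 1 (z n)) (index_iota 0 N).
rewrite big_mkord => h; rewrite ltNge; apply/negP; rewrite negbK.
have {}h := h (fun n => ltac:(by rewrite le_max lexx)).
rewrite big_mkord in h; apply: le_trans h; rewrite lerDr.
by apply: sumr_ge0 => n _; rewrite subr_ge0 le_max lexx.
Qed.

End real_products.

Section operator_norms.
Context {R : realType} {H : nat -> hilbertType R}.
Variables (A : forall n, {linear H n -> H n}).
Hypothesis Ab : forall n, bounded_op_on setT (A n).

Lemma le_opnormT n u : rnorm (A n u) <= opnorm setT (A n) * rnorm u.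
Proof.
have := Ab n; rewrite -[in X in X -> _]setT_span => h.
have := le_opnorm h; rewrite setT_span; exact.
Qed.

Lemma opnormT_ge0 n : 0 <= opnorm setT (A n).
Proof.
apply: (ub_le_sup (opnorm_ub (Ab n))); exists 0; last by rewrite linear0; exact: rnorm0.
by split=> //; rewrite normr0.
Qed.

Lemma opnormT_le n C D : 0 <= C -> 0 <= D ->
  (forall u, rnorm (A n u) * C <= D * rnorm u) -> opnorm setT (A n) * C <= D.
Proof.
rewrite le_eqVlt => /predU1P[<- D0 _|C0 D0 h]; first by rewrite mulr0.
rewrite -ler_pdivlMr //; apply: opnorm_le => // [|u _]; first exact: divr_ge0 (ltW C0).
by rewrite mulrAC ler_pdivlMr.
Qed.

(** The supremum is taken in one coordinate at a time, the others being fixed; the weights [p] and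
    [q] absorb the remaining factors. *)
Lemma prod_opnorm_le (s : seq nat) p q : uniq s -> 0 <= p -> 0 <= q ->
  (forall x : forall n, H n, \prod_(n <- s) rnorm (A n (x n)) * p <=
    q * \prod_(n <- s) rnorm (x n)) ->
  \prod_(n <- s) opnorm setT (A n) * p <= q.
Proof.
elim: s p q => [|k s IH] p q /=.
  by move=> _ _ _ /(_ (fun=> 0)); rewrite !big_nil mulr1.
move=> /andP[ks us] p0 q0 hx; rewrite big_cons -mulrA.
apply: opnormT_le => //.
  by rewrite mulr_ge0 // prodr_ge0 // => n _; exact: opnormT_ge0.
move=> u; rewrite mulrCA; apply: IH => //; rewrite ?mulr_ge0 ?rnorm_ge0 // => x.
have := hx (eqtype.dfwith x u); rewrite !big_cons eqtype.dfwith_in.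
have e (f : forall n, H n -> R) :
    \prod_(n <- s) f n (eqtype.dfwith x u n) = \prod_(n <- s) f n (x n).
  rewrite big_seq [RHS]big_seq; apply: eq_bigr => n ns; rewrite eqtype.dfwith_out //.
  by apply: contraNneq ks => ->.
rewrite (e (fun n v => rnorm (A n v))) (e (fun n v => rnorm v)) /=.
by rewrite -!mulrA mulrCA.
Qed.

End operator_norms.

(** * Estimates linking the operator norms, the sequence [A y] and a given operator *)

Section main_estimates.
Context {R : realType} {H : nat -> hilbertType R} (T : complete_tensor H).
Variables (A : forall n, {linear H n -> H n}).
Hypothesis Ab : forall n, bounded_op_on setT (A n).
Implicit Types (h f g y : forall n, H n).

Definition tail_norm h F : R :=
  rnorm (qprod (mix F (fun=> 1) (fun n => (rnorm (h n))%:C%C))).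

Lemma rnorm_tens_mix F (x h : forall n, H n) : is_C0seq h ->
  rnorm (tens T (mix F x h)) = \prod_(n <- F) rnorm (x n) * tail_norm h F.
Proof.
move=> hs; rewrite rnorm_tens; last first.
  by apply: (C0_cofin (F := F) _ hs) => n /negbTE nF; rewrite /mix nF.
have -> : qprod (fun n => (rnorm (mix F x h n))%:C%C) =
    qprod (mix F (fun n => (rnorm (x n))%:C%C) (fun n => (rnorm (h n))%:C%C)) :> R[i].
  by apply: qprod_eq => n; rewrite /mix; case: ifP.
rewrite qprod_mix; last exact/C0seqE.
rewrite rnormM rnorm_prod; congr (_ * _); apply: eq_bigr => n _.
by rewrite rnormR ger0_norm ?rnorm_ge0.
Qed.

Lemma tail_norm_near h e : is_C0seq h -> 0 < e -> exists F0 : {fset nat},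
  forall F : {fset nat}, (F0 `<=` F)%fset -> `|tail_norm h F - 1| < e.
Proof.
move=> /C0seqE/near1_qprod_tail/cvg_netP hs e0; have [F0 F0P] := hs e e0.
exists F0 => F /F0P; rewrite /tail_norm; set q := qprod _ => h1.
rewrite ltr_norml; have := rnorm_sub_le q 1; have := rnorm_sub_le 1 q.
rewrite (rdistC 1) rnorm1 => k1 k2; apply/andP; split; lra.
Qed.

Lemma app_mix F (x h : forall n, H n) :
  app_seq A (mix F x h) = mix F (app_seq A x) (app_seq A h).
Proof.
apply: functional_extensionality_dep => n.
by rewrite /app_seq /mix; case: ifP.
Qed.

(** [B] is tested on tensors with arbitrary entries on [F] and those of [h] elsewhere; both norms
    split into a product over [F] and a tail independent of these entries. *)
Lemma prod_opnorm_tail y h B F : is_C0seq h -> C0_equiv h y ->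
  is_C0seq (app_seq A h) ->
  bounded_op_on (incomplete_tensor T y) B ->
  (forall x, B (tens T (mix F x h)) = tens T (app_seq A (mix F x h))) ->
  \prod_(n <- F) opnorm setT (A n) * tail_norm (app_seq A h) F <=
    opnorm (incomplete_tensor T y) B * tail_norm h F.
Proof.
move=> hs hy Ahs Bb BA; apply: prod_opnorm_le => //; first exact: fset_uniq.
- exact: rnorm_ge0.
- rewrite mulr_ge0 ?rnorm_ge0 //.
  apply: (ub_le_sup (opnorm_ub Bb)); exists 0.
    by split; [exact: closure_lin0|rewrite normr0].
  by rewrite (bounded_op0 Bb) normr0.
move=> x; rewrite mulrAC -mulrA -(rnorm_tens_mix _ (app_seq A x)) // mulrC.
rewrite -app_mix -BA mulrC -rnorm_tens_mix //; apply: le_opnorm => //.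
have mh n : n \notin F -> mix F x h n = h n by rewrite /mix => /negbTE ->.
by apply: closure_gen; apply: mem_gens; [exact: C0_cofin mh hs|exact: C0_equiv_cofin mh hy].
Qed.

Let c n := Num.max 1 (opnorm setT (A n)) ^+ 2.

Lemma max_bound n u : rnorm (A n u) ^+ 2 <= c n * rnorm u ^+ 2.
Proof.
rewrite /c -exprMn ler_pXn2r ?nnegrE ?mulr_ge0 ?rnorm_ge0 ?le_max ?ler01 //.
by apply: le_trans (le_opnormT Ab u) _; rewrite ler_wpM2r ?rnorm_ge0 // le_max lexx orbT.
Qed.

Lemma near1_max_sqr :
  near1 (fun n => (Num.max 1 (opnorm setT (A n)))%:C%C : R[i]) ->
  near1 (fun n => (c n)%:C%C : R[i]).
Proof. by move=> ?; apply: (near1_sqr _).1 => // n; rewrite le_max ler01. Qed.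

(** The common end of both necessity proofs: a tensor of the given class whose image is elementary,
    nonzero and again of that class. *)
Lemma conditions_of_op y h B : is_C0seq y -> is_C0seq h -> C0_equiv h y ->
  is_C0seq (app_seq A h) -> C0_equiv (app_seq A h) y ->
  (forall n, app_seq A h n != 0) ->
  bounded_op_on (incomplete_tensor T y) B ->
  (forall F x, B (tens T (mix F x h)) = tens T (app_seq A (mix F x h))) ->
  [/\ forall n, exists x, A n x != 0,
      exists a : R, uncond_prod (fun n => Num.max 1 (opnorm setT (A n))) a
    & abs_summable (fun n => 1 - inner (A n (y n)) (y n))].
Proof.
move=> ys hs hy Ahs Ahy Ah0 Bb BA.
have on0 n : 0 < opnorm setT (A n).
  rewrite lt_def opnormT_ge0 // andbT; apply: contraNneq (Ah0 n) => o0.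
  have := le_opnormT Ab (h n); rewrite o0 mul0r => le0.
  by rewrite -rnorm_eq0 eq_le rnorm_ge0 andbT.
have [F1 F1P] := tail_norm_near Ahs (ltac:(lra) : 0 < (2^-1 : R)).
have [F2 F2P] := tail_norm_near hs (ltac:(lra) : 0 < (2^-1 : R)).
pose F0 := (F1 `|` F2)%fset; pose b := opnorm (incomplete_tensor T y) B.
(* Both tails lie between 1/2 and 3/2, so their quotient is below 3. *)
have bound (F : {fset nat}) : (F0 `<=` F)%fset ->
    \prod_(n <- F) opnorm setT (A n) <= 4 * `|b|.
  move=> /fsubUsetP[/F1P h1 /F2P h2].
  have := prod_opnorm_tail hs hy Ahs Bb (BA F); rewrite -/b.
  move: h1 h2; rewrite !ltr_norml => /andP[h1 h1'] /andP[h2 h2'].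
  have : 0 <= \prod_(n <- F) opnorm setT (A n).
    by apply: prodr_ge0 => n _; exact: ltW.
  have := ler_norm b; have := normr_ge0 b.
  move: (\prod_(_ <- _) _) (tail_norm _ _) (tail_norm _ _) h1 h1' h2 h2' => p u v.
  by move: `|b| => nb; nra.
pose m := \prod_(n <- F0) Num.min 1 (opnorm setT (A n)).
have m0 : 0 < m by apply: prodr_gt0 => n _; rewrite lt_min ltr01 on0.
have maxs : near1 (fun n => (Num.max 1 (opnorm setT (A n)))%:C%C : R[i]).
  apply: (@near1_le _ _ (fun n => Num.max 1 (opnorm setT (A n)) - 1)).
    by move=> n; rewrite rdist1R distrC ger0_norm // subr_ge0 le_max lexx.
  exists (4 * `|b| / m) => F.
  have := @sum_le_prod _ (fun n => Num.max 1 (opnorm setT (A n))) F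
    (fun n => ltac:(by rewrite le_max lexx)).
  suff : \prod_(n <- F) Num.max 1 (opnorm setT (A n)) <= 4 * `|b| / m by lra.
  (* [bound] applies only to sets containing [F0], whose norms may be small. On [F'] the norm
     exceeds 1, so over the union of [F'] and [F0] the product of the norms is that of the maxima
     times that of the minima, and the latter is [m]. *)
  pose F' := [fset n in F | 1 < opnorm setT (A n)]%fset.
  rewrite ler_pdivlMr //; apply: le_trans (bound (F' `|` F0)%fset (fsubsetUr _ _)).
  have F'F : (F' `<=` F)%fset by apply/fsubsetP => n; rewrite !inE => /andP[].
  rewrite -(big_fset_incl _ F'F) => [|n nF]; last first.
    by rewrite !inE nF /= -leNgt => /max_idPl.
  have -> : m = \prod_(n <- (F' `|` F0)%fset) Num.min 1 (opnorm setT (A n)).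
    apply: big_fset_incl (fsubsetUr _ _) _ => n; rewrite !inE => /orP[|->] //.
    by move=> /andP[_ /ltW/min_idPl].
  have -> : \prod_(n <- (F' `|` F0)%fset) opnorm setT (A n) =
      \prod_(n <- (F' `|` F0)%fset) Num.max 1 (opnorm setT (A n)) *
      \prod_(n <- (F' `|` F0)%fset) Num.min 1 (opnorm setT (A n)).
    by rewrite -big_split; apply: eq_bigr => n _; rewrite /= maxEle minEle; case: ifP; rewrite ?mul1r ?mulr1.
  apply: ler_wpM2r; first by apply: prodr_ge0 => n _; rewrite le_min ler01 ltW.
  rewrite (prod_fsub _ (fsubsetUl F' F0)) ler_peMr //.
    by apply: prodr_ge0 => n _; rewrite le_max ler01.
  have := @sum_le_prod _ (fun n => Num.max 1 (opnorm setT (A n)))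
    ((F' `|` F0) `\` F')%fset (fun n => ltac:(by rewrite le_max lexx)).
  by apply: le_trans; rewrite lerDr sumr_ge0 // => n _; rewrite subr_ge0 le_max lexx.
have cs := near1_max_sqr maxs.
have c0 n : 0 <= c n by rewrite sqr_ge0.
split.
- by move=> n; exists (h n); exact: Ah0.
- exact/near1_max.
(* Summable defect passes from [h] to [y]; condition (iii) results from the chain of equivalences
   [A y], [A h], [y]. *)
have dh := (defect_C0 cs max_bound hs).1 Ahs.
have dy := defect_bsum c0 cs max_bound hs ys hy dh.
have Ays := (defect_C0 cs max_bound ys).2 dy.
have AyAh : C0_equiv (app_seq A y) (app_seq A h).
  by apply/(defect_equiv cs max_bound ys hs dy dh); exact: C0_equiv_sym.
exact: C0_equiv_trans Ays Ahs ys AyAh Ahy.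
Qed.

Lemma app_equiv y h : is_C0seq y ->
  near1 (fun n => (Num.max 1 (opnorm setT (A n)))%:C%C : R[i]) ->
  is_C0seq (app_seq A y) -> C0_equiv (app_seq A y) y ->
  is_C0seq h -> C0_equiv h y -> is_C0seq (app_seq A h) /\ C0_equiv (app_seq A h) y.
Proof.
move=> ys /near1_max_sqr cs Ays Ayy hs hy.
have c0 n : 0 <= c n by rewrite sqr_ge0.
have dy := (defect_C0 cs max_bound ys).1 Ays.
have yh := C0_equiv_sym hy.
have dh := defect_bsum c0 cs max_bound ys hs yh dy.
have Ahs := (defect_C0 cs max_bound hs).2 dh; split=> //.
apply: (C0_equiv_trans Ahs Ays ys _ Ayy).
exact/(defect_equiv cs max_bound hs ys dh dy).
Qed.

(** [|A y|^2] lies between [2 Re <A y, y> - |y|^2], from positivity of [|A y - y|^2], and [c |y|^2];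
    both bounds are near 1. *)
Lemma app_C0 y : is_C0seq y ->
  near1 (fun n => (Num.max 1 (opnorm setT (A n)))%:C%C : R[i]) ->
  C0_equiv (app_seq A y) y -> is_C0seq (app_seq A y).
Proof.
move=> /C0seq_sqr ys /near1_max_sqr cs /C0_equivE Ayy; apply/C0seq_sqr.
have cys := near1M cs ys; have d2 : 0 <= (2 : R) by lra.
apply: near1_le (bsumD cys (bsumD (bsumZ d2 Ayy) ys)) => n.
rewrite -rmorphM !rdist1R ler_norml; have up := max_bound (y n).
have := sqr_ge0 (rnorm (app_seq A y n - y n)); rewrite rnormB2.
have := rnorm_Re (1 - inner (app_seq A y n) (y n)).
rewrite ReB /= ler_norml => /andP[_ h1] h2.
have := ler_norm (c n * rnorm (y n) ^+ 2 - 1); rewrite distrC => h3.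
have h4 := normr_ge0 (1 - c n * rnorm (y n) ^+ 2).
have := ler_norm (rnorm (y n) ^+ 2 - 1); rewrite distrC => h5.
have h6 := normr_ge0 (1 - rnorm (y n) ^+ 2).
have h7 := rnorm_ge0 (1 - inner (app_seq A y n) (y n)).
apply/andP; split; [rewrite /app_seq in h2 *|]; rewrite /app_seq in h1 h2 h7 *; lra.
Qed.

(** Only norms below 1 need an argument: [|A_n| >= |A_n y_n| / |y_n|], and outside a finite set
    [|y_n| > 1/2], whence the factor 2. *)
Lemma near1_opnorm y : is_C0seq y ->
  near1 (fun n => (Num.max 1 (opnorm setT (A n)))%:C%C : R[i]) ->
  is_C0seq (app_seq A y) -> near1 (fun n => (opnorm setT (A n))%:C%C : R[i]).
Proof.
move=> /C0seqE ys ms /C0seqE Ays.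
have [F0 F0P] := near1_tail ys (ltac:(lra) : 0 < (2^-1 : R)).
have d2 : 0 <= (2 : R) by lra.
apply: (bsum_le_cofin (F0 := F0)) (bsumD ms (bsumZ d2 (bsumD ys Ays))) => n.
  by rewrite addr_ge0 ?mulr_ge0 ?addr_ge0 ?rnorm_ge0.
move=> nF0; have /F0P : [disjoint F0 & [fset n]]%fset by rewrite fdisjointX1.
rewrite big_seq_fset1 rdistC !rdist1R.
have := le_opnormT Ab (y n); rewrite -/(app_seq A y n).
have := rnorm_ge0 (y n); have := rnorm_ge0 (app_seq A y n).
move: (rnorm (y n)) (rnorm (app_seq A y n)) (opnorm setT (A n)) => r s o s0 r0 so.
rewrite ltr_norml => /andP[r1 r2].
have := ler_norm (1 - r); have := ler_norm (s - 1); rewrite (distrC s).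
have := normr_ge0 (1 - r); have := normr_ge0 (1 - s).
have [ge1|lt1] := leP 1 o.
  have := normr_ge0 (1 - o); lra.
rewrite (@ger0_norm _ (1 - o)); last by rewrite subr_ge0 ltW.
rewrite subrr normr0.
have := ler_norm (1 - s); have := ler_norm (r - 1); rewrite (distrC r); nra.
Qed.

End main_estimates.

(** * Necessity of the conditions *)

Section conditions.
Context {R : realType} {H : nat -> hilbertType R} (T : complete_tensor H).
Variables (A : forall n, {linear H n -> H n}) (y : forall n, H n).
Hypothesis Ab : forall n, bounded_op_on setT (A n).
Hypothesis ys : is_C0seq y.

Let W := incomplete_tensor T y.

Lemma tens_span h : is_C0seq h -> C0_equiv h y -> W (tens T h).
Proof. by move=> hs hy; apply: closure_gen; exact: mem_gens. Qed.

(** A nonzero pairing with a generator is what turns membership of an elementary tensor in the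
    closed span into equivalence with [y]. *)
Lemma nonzero_pairing v : W v -> v != 0 ->
  exists g, [/\ is_C0seq g, C0_equiv g y & inner v (tens T g) != 0].
Proof.
move=> Wv v0; apply: contrapT => ng; move/eqP: v0; apply.
apply: (@closed_span_orthogonal _ _ (gens y) v Wv) => _ [g [gs gy] <-]; apply/eqP; apply: contrapT => /negP vg.
by apply: ng; exists g.
Qed.

Lemma conditions_of_factorwise B :
  factorwise_tensor_op T A y B -> nonzero_on W B ->
  [/\ forall n, exists x, A n x != 0,
      exists a : R, uncond_prod (fun n => Num.max 1 (opnorm setT (A n))) a
    & abs_summable (fun n => 1 - inner (A n (y n)) (y n))].
Proof.
move=> [Bb BA] /(bounded_op_nonzero Bb)[_ [h [hs hy] <-]].
have [AhC AhW ->] := BA h (C0_Cseq hs) (tens_span hs hy) => Ah0.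
have q0 : qprod (fun n => (rnorm (app_seq A h n) ^+ 2)%:C%C) != 0 :> R[i].
  by rewrite -(tens_sqr T) // -rnorm_eq0 rnormR normr_eq0 sqrf_eq0 rnorm_eq0.
have Ahs : is_C0seq (app_seq A h) by apply/C0seq_sqr; exact: uncond_near1 (qprod_neq0 q0) q0.
have Ahn n : app_seq A h n != 0.
  have := uncond_neq0 n (qprod_neq0 q0) q0; apply: contraNneq => ->.
  by rewrite rnorm0 expr0n.
have [g [gs gy]] := nonzero_pairing AhW Ah0.
rewrite (tens_inner T AhC (C0_Cseq gs)) => k.
have Ahg : C0_equiv (app_seq A h) g by apply/C0_equivE; exact: uncond_near1 (qprod_neq0 k) k.
have Ahy := C0_equiv_trans Ahs gs ys Ahg gy.
apply: (conditions_of_op Ab ys hs hy Ahs Ahy Ahn Bb) => F x.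
have mh n : n \notin F -> mix F x h n = h n by rewrite /mix => /negbTE ->.
have ms := C0_cofin mh hs; have my := C0_equiv_cofin mh hy.
by have [] := BA _ (C0_Cseq ms) (tens_span ms my).
Qed.

Lemma strong_limit_tens B h : strong_limit_tensor_op T A y B ->
  is_C0seq h -> C0_equiv h y ->
  tens T (app_seq_on A F h) @[F --> totally] --> B (tens T h).
Proof.
move=> [_ [AF [AFp AFB]]] hs hy; have := AFB _ (tens_span hs hy).
by under eq_fun do rewrite (AFp _).2 //.
Qed.

Lemma strong_limit_tensE B h : strong_limit_tensor_op T A y B ->
  is_C0seq h -> C0_equiv h y ->
  is_C0seq (app_seq A h) -> C0_equiv (app_seq A h) y ->
  B (tens T h) = tens T (app_seq A h).
Proof.
move=> BS hs hy Ahs Ahy.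
have Ahh := C0_equiv_trans Ahs ys hs Ahy (C0_equiv_sym hy).
have l1 := strong_limit_tens BS hs hy; have l2 := @cvg_tens_app _ _ T _ _ hs Ahs Ahh.
exact: (cvg_unique (@norm_hausdorff _ T) l1 l2).
Qed.

(** The image of an elementary tensor is not known to be elementary. Limits of squared norms and of
    pairings, freed of their tails by [mix_net], show that [A h] is a C0-sequence equivalent to [y];
    only then is the limit identified as its tensor. *)
Lemma conditions_of_strong B :
  strong_limit_tensor_op T A y B -> nonzero_on W B ->
  [/\ forall n, exists x, A n x != 0,
      exists a : R, uncond_prod (fun n => Num.max 1 (opnorm setT (A n))) a
    & abs_summable (fun n => 1 - inner (A n (y n)) (y n))].
Proof.
move=> BS Bn; have [Bb _] := BS.
have [_ [h [hs hy] <-] Bh0] := bounded_op_nonzero Bb Bn.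
have hl := strong_limit_tens BS hs hy.
have sq0 : (rnorm (B (tens T h)) ^+ 2)%:C%C != 0 :> R[i].
  by rewrite -rnorm_eq0 rnormR normr_eq0 sqrf_eq0 rnorm_eq0.
have nl : netprod (fun n => (rnorm (app_seq A h n) ^+ 2)%:C%C) @ totally -->
    ((rnorm (B (tens T h)) ^+ 2)%:C%C : R[i]^o).
  apply: (@mix_net _ _ (fun n => (rnorm (h n) ^+ 2)%:C%C)); first exact/C0seq_sqr.
  have -> : (fun F => qprod (mix F (fun n => (rnorm (app_seq A h n) ^+ 2)%:C%C)
      (fun n => (rnorm (h n) ^+ 2)%:C%C))) =
      (fun F => (rnorm (tens T (app_seq_on A F h)) ^+ 2)%:C%C) :> (_ -> R[i]^o).
    apply/funext => F; rewrite tens_sqr; last exact/C0_Cseq/app_on_C0.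
    by apply: qprod_eq => n; rewrite /mix /app_seq_on; case: ifP.
  exact: cvg_sqr.
have Ahs : is_C0seq (app_seq A h) by apply/C0seq_sqr; exact: net_near1 nl sq0.
have Ahn n : app_seq A h n != 0.
  have := net_neq0 n nl sq0; apply: contraNneq => ->.
  by rewrite rnorm0 expr0n.
have [BW _ _] := Bb.
have [g [gs gy k]] := nonzero_pairing (BW _ (tens_span hs hy)) Bh0.
have hg := C0_equiv_trans hs ys gs hy (C0_equiv_sym gy).
have Ahg : C0_equiv (app_seq A h) g.
  apply/C0_equivE; apply: net_near1 k.
  apply: (@mix_net _ _ (fun n => inner (h n) (g n))); first exact/C0_equivE.
  have -> : (fun F => qprod (mix F (fun n => inner (app_seq A h n) (g n))
      (fun n => inner (h n) (g n)))) =
      (fun F => inner (tens T (app_seq_on A F h)) (tens T g)) :> (_ -> R[i]^o).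
    apply/funext => F; rewrite tens_inner; try exact/C0_Cseq; last first.
      exact/C0_Cseq/app_on_C0.
    by apply: qprod_eq => n; rewrite inner_app_on.
  exact: cvg_inner.
have Ahy := C0_equiv_trans Ahs gs ys Ahg gy.
apply: (conditions_of_op Ab ys hs hy Ahs Ahy Ahn Bb) => F x.
have mh n : n \notin F -> mix F x h n = h n by rewrite /mix => /negbTE ->.
have Amh n : n \notin F -> app_seq A (mix F x h) n = app_seq A h n.
  by move=> nF; rewrite /app_seq mh.
by apply: strong_limit_tensE => //; [exact: C0_cofin mh hs|exact: C0_equiv_cofin mh hy|
  exact: C0_cofin Amh Ahs|exact: C0_equiv_cofin Amh Ahy].
Qed.

(** * Sufficiency of the conditions, uniqueness and the norm formula *)

Hypothesis max_near1 : near1 (fun n => (Num.max 1 (opnorm setT (A n)))%:C%C : R[i]).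
Hypothesis Ayy : C0_equiv (app_seq A y) y.

Let Ays : is_C0seq (app_seq A y).
Proof. exact: (app_C0 Ab ys max_near1 Ayy). Qed.

Let appP h : is_C0seq h -> C0_equiv h y ->
  is_C0seq (app_seq A h) /\ C0_equiv (app_seq A h) y.
Proof. exact: (app_equiv Ab ys max_near1 Ays Ayy). Qed.

Let norms : near1 (fun n => (opnorm setT (A n))%:C%C : R[i]).
Proof. exact: (near1_opnorm Ab ys max_near1 Ays). Qed.

Definition norm_prod : R := rnorm (qprod (fun n => (opnorm setT (A n))%:C%C : R[i])).

Lemma norm_prod_uncond : uncond_prod (fun n => opnorm setT (A n)) norm_prod.
Proof.
apply/uncond_prod_RC; rewrite -qprod_ge0 //; first exact: near1_uncond.
by move=> n; exact: opnormT_ge0.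
Qed.

(** The norms themselves being near 1, [c n = |A_n|^2] is admissible and gives the sharp bound. *)
Lemma complete_of_conditions : exists2 B, complete_tensor_op T A B &
  forall x, rnorm (B x) <= norm_prod * rnorm x.
Proof.
pose c n := opnorm setT (A n) ^+ 2.
have c0 n : 0 <= c n by rewrite sqr_ge0.
have cs : near1 (fun n => (c n)%:C%C : R[i]).
  by apply: (near1_sqr _).1 norms => n; exact: opnormT_ge0.
have Ac n u : rnorm (A n u) ^+ 2 <= c n * rnorm u ^+ 2.
  rewrite /c -exprMn ler_pXn2r ?nnegrE ?mulr_ge0 ?rnorm_ge0 ?opnormT_ge0 //.
  exact: le_opnormT.
have [B BA BM] := complete_op_ex T c0 cs Ac; exists B => // x.
suff <- : Num.sqrt (prod_bound c) = norm_prod by [].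
have -> : prod_bound c = norm_prod ^+ 2; last by rewrite sqrtr_sqr ger0_norm ?rnorm_ge0.
rewrite /prod_bound.
have -> : qprod (fun n => (c n)%:C%C) =
    qprod (fun n => (opnorm setT (A n))%:C%C) ^+ 2 :> R[i].
  rewrite expr2 -qprodM //.
  by apply: qprod_eq => n; rewrite /c expr2 rmorphM.
by rewrite (qprod_ge0 (opnormT_ge0 Ab) norms) -rmorphXn.
Qed.

Variable B : T -> T.
Hypothesis BA : complete_tensor_op T A B.

Let Bb : bounded_op_on W B.
Proof. exact: (complete_op_invariant BA appP). Qed.

Lemma complete_factorwise : factorwise_tensor_op T A y B.
Proof.
split=> // h hC Wh; have [AhC BhE] := BA.2 h hC.
by split=> //; rewrite -BhE; have [BW _ _] := Bb; exact: BW.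
Qed.

Lemma complete_strong : strong_limit_tensor_op T A y B.
Proof.
split=> //.
pose c n := Num.max 1 (opnorm setT (A n)) ^+ 2.
have c0 n : 0 <= c n by rewrite sqr_ge0.
have cs := near1_max_sqr max_near1.
have /choice[AF AFP] F : exists AF : T -> T, partial_tensor_op T A y F AF /\
    forall x, rnorm (AF x) <= Num.sqrt (\prod_(n <- F) c n) * rnorm x.
  by have [AF ? ?] := partial_op_ex T c0 (max_bound Ab) y F; exists AF.
exists AF; split=> [F|]; first exact: (AFP F).1.
have /cvg_netP/(_ 1 ltr01)[F0 F0P] := near1_net cs.
pose q := qprod (fun n => (c n)%:C%C : R[i]).
apply: (@strong_density _ _ _ _ _ (Num.sqrt (rnorm q + 1))) => //.
- by move=> F; have [[]] := AFP F.
- exists F0 => F /F0P h x _; apply: le_trans ((AFP F).2 x) _.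
  rewrite ler_wpM2r ?rnorm_ge0 // ler_wsqrtr //.
  have := rnorm_sub_le (netprod (fun n => (c n)%:C%C) F) q.
  rewrite [X in X - _]rnorm_prod.
  under eq_bigr do rewrite rnormR ger0_norm //.
  by move: h; rewrite -/c -/q => h; lra.
move=> _ [h [hs hy] <-]; have [Ahs Ahy] := appP hs hy.
rewrite (BA.2 h (C0_Cseq hs)).2.
under eq_fun do rewrite ((AFP _).1.2 h) //.
apply: cvg_tens_app => //.
exact: C0_equiv_trans Ahs ys hs Ahy (C0_equiv_sym hy).
Qed.

(** Since [A y] is a C0-sequence, [A_n y_n = 0] for finitely many [n] only; replacing these entries
    of [y] by vectors outside the kernels stays in the same class. *)
Lemma complete_nonzero : (forall n, exists x, A n x != 0) -> nonzero_on W B.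
Proof.
move=> An0; pose x n := projT1 (cid (An0 n)).
have x0 n : A n (x n) != 0 by rewrite /x; case: cid.
pose h n := if A n (y n) != 0 then y n else x n.
have Ah0 n : app_seq A h n != 0 by rewrite /app_seq /h; case: ifP => // _; exact: x0.
have /C0seqE Ays' := Ays.
have [F0 F0P] := near1_tail Ays' ltr01.
have hy n : n \notin F0 -> h n = y n.
  move=> nF0; have /F0P : [disjoint F0 & [fset n]]%fset by rewrite fdisjointX1.
  rewrite big_seq_fset1 /h; case: ifP => // /negbFE/eqP.
  by rewrite /app_seq => ->; rewrite rnorm0 sub0r rnormN rnorm1 ltxx.
have hs := C0_cofin hy ys.
have hyy := C0_equiv_cofin hy (C0_equiv_refl ys).
have [Ahs Ahy] := appP hs hyy.
exists (tens T h); first exact: tens_span.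
rewrite (BA.2 h (C0_Cseq hs)).2 -rnorm_eq0 rnorm_tens // rnorm_eq0.
apply: near1_neq0 => [|n]; first exact/C0seqE.
by rewrite -rnorm_eq0 rnormR normr_eq0 rnorm_eq0 Ah0.
Qed.

Lemma factorwise_unique B1 : factorwise_tensor_op T A y B1 ->
  forall x, W x -> B1 x = B x.
Proof.
move=> [B1b B1A]; apply: (bounded_op_eq B1b Bb) => _ [h [hs hy] <-].
have hC := C0_Cseq hs; rewrite (BA.2 h hC).2.
by have [] := B1A h hC (tens_span hs hy).
Qed.

Lemma strong_unique B2 : strong_limit_tensor_op T A y B2 ->
  forall x, W x -> B2 x = B x.
Proof.
move=> B2S; have [B2b _] := B2S; apply: (bounded_op_eq B2b Bb) => _ [h [hs hy] <-].
have [Ahs Ahy] := appP hs hy.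
by rewrite (BA.2 h (C0_Cseq hs)).2 (strong_limit_tensE B2S).
Qed.

Lemma opnorm_complete : opnorm W B = norm_prod.
Proof.
have W0 : W 0 by exact: closure_lin0.
apply/le_anti/andP; split.
  have [B' B'A B'M] := complete_of_conditions.
  apply: opnorm_le => //; first exact: rnorm_ge0.
  move=> x Wx; suff -> : B x = B' x by exact: B'M.
  have B'b : bounded_op_on W B' by exact: complete_op_invariant B'A appP.
  move: x Wx; apply: (bounded_op_eq Bb B'b) => _ [h [hs _] <-].
  have hC := C0_Cseq hs; by rewrite (BA.2 h hC).2 (B'A.2 h hC).2.
set b := opnorm W B.
have b0 : 0 <= b.
  apply: (ub_le_sup (opnorm_ub Bb)); exists 0; first by split=> //; rewrite normr0.
  by rewrite (bounded_op0 Bb); exact: rnorm0.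
have key (F : {fset nat}) : \prod_(n <- F) opnorm setT (A n) * tail_norm (app_seq A y) F <=
    b * tail_norm y F.
  apply: (prod_opnorm_tail Ab ys (C0_equiv_refl ys) Ays Bb) => x.
  have mh n : n \notin F -> mix F x y n = y n by rewrite /mix => /negbTE ->.
  exact: (BA.2 _ (C0_Cseq (C0_cofin mh ys))).2.
have Q0 : 0 <= norm_prod by exact: rnorm_ge0.
apply/ler_addgt0Pr => e e0.
(* With [p] the finite product of norms, [norm_prod <= p + d] and
   [p <= b (1 + d) + (norm_prod + d) d]; as [d^2 <= d], the total error is at most
   [d (b + norm_prod + 2)]. *)
pose d := Num.min 1 (e / (b + norm_prod + 2)).
have k0 : 0 < b + norm_prod + 2 by lra.
have d0 : 0 < d by rewrite lt_min ltr01 divr_gt0.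
have d1 : d <= 1 by rewrite ge_min lexx.
have de : d * (b + norm_prod + 2) <= e by rewrite -ler_pdivlMr // ge_min lexx orbT.
have [F1 F1P] := tail_norm_near Ays d0; have [F2 F2P] := tail_norm_near ys d0.
have /cvg_netP/(_ d d0)[F3 F3P] := near1_net norms.
pose F := (F1 `|` F2 `|` F3)%fset.
have sF G : [|| G == F1, G == F2 | G == F3] -> (G `<=` F)%fset.
  by case/or3P => /eqP ->; apply/fsubsetP => n; rewrite !inE => ->; rewrite ?orbT.
have h1 := F1P F (sF F1 ltac:(by rewrite eqxx)).
have h2 := F2P F (sF F2 ltac:(by rewrite eqxx orbT)).
have h3 := F3P F (sF F3 ltac:(by rewrite eqxx !orbT)).
have := rnorm_sub_le (qprod (fun n => (opnorm setT (A n))%:C%C)) 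
  (netprod (fun n => (opnorm setT (A n))%:C%C : R[i]) F).
have := rnorm_sub_le (netprod (fun n => (opnorm setT (A n))%:C%C : R[i]) F) 
  (qprod (fun n => (opnorm setT (A n))%:C%C)).
rewrite (rdistC (qprod _)) -/norm_prod.
have -> : rnorm (netprod (fun n => (opnorm setT (A n))%:C%C : R[i]) F) =
    \prod_(n <- F) opnorm setT (A n).
  rewrite [LHS]rnorm_prod; apply: eq_bigr => n _.
  by rewrite rnormR ger0_norm // opnormT_ge0.
have := key F; move: h1 h2 h3; rewrite !ltr_norml.
have : 0 <= \prod_(n <- F) opnorm setT (A n).
  by apply: prodr_ge0 => n _; exact: opnormT_ge0.
move: (\prod_(n <- F) _) (tail_norm (app_seq A y) F) (tail_norm y F) => p t1 t2 p0.
move=> /andP[h1 h1'] /andP[h2 h2'] h3 h4 h5 h6.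
have : p * (1 - t1) <= (norm_prod + d) * d.
  apply: (@le_trans _ _ (p * d)); first by apply: ler_wpM2l => //; lra.
  by apply: ler_wpM2r; lra.
have : b * t2 <= b * (1 + d) by apply: ler_wpM2l => //; lra.
have : d * d <= d by rewrite ler_piMr // ltW.
lra.
Qed.

End conditions.

Lemma eq_opnorm {R : realType} {V : hilbertType R} (W : set V) (B1 B2 : V -> V) :
  (forall x, W x -> B1 x = B2 x) -> opnorm W B1 = opnorm W B2.
Proof.
move=> B12; congr sup; apply/seteqP.
by split=> r [x [Wx x1] <-]; exists x => //; rewrite B12.
Qed.

Theorem theorem6p2 (R : realType) (H : nat -> hilbertType R)
    (T : complete_tensor H) (y : forall n, H n) (hy : is_C0seq y)
    (A : forall n, {linear H n -> H n}) (hA : forall n, continuous (A n)) :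
  let W := incomplete_tensor T y in
  let cond_a := exists B : T -> T,
    factorwise_tensor_op T A y B /\ nonzero_on W B in
  let cond_b := exists B : T -> T,
    strong_limit_tensor_op T A y B /\ nonzero_on W B in
  let cond_c :=
    [/\ forall n, exists x, A n x != 0,
        exists a : R, uncond_prod (fun n => Num.max 1 (opnorm setT (A n))) a
      & abs_summable (fun n => 1 - inner (A n (y n)) (y n))] in
  [/\ cond_a <-> cond_b,
      cond_b <-> cond_c
    & cond_c ->
      (exists B : T -> T, complete_tensor_op T A B) /\
      forall B B1 B2 : T -> T,
        complete_tensor_op T A B ->
        factorwise_tensor_op T A y B1 ->
        strong_limit_tensor_op T A y B2 ->
        [/\ forall x, W x -> W (B x),
            forall x, W x -> B1 x = B2 x /\ B2 x = B x,
            opnorm W B1 = opnorm W B2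
          & uncond_prod (fun n => opnorm setT (A n)) (opnorm W B1)]].
Proof.
move=> W cond_a cond_b cond_c.
have Ab n : bounded_op_on setT (A n) by exact: continuous_bounded_op.
have ac : cond_a -> cond_c.
  by move=> [B [BA B0]]; exact: (conditions_of_factorwise Ab hy BA B0).
have bc : cond_b -> cond_c.
  by move=> [B [BA B0]]; exact: (conditions_of_strong Ab hy BA B0).
have ca : cond_c -> cond_a.
  move=> [An0 /near1_max ms Ayy].
  have [B BA _] := complete_of_conditions T Ab hy ms Ayy.
  exists B; split; first exact: (complete_factorwise Ab hy ms Ayy BA).
  exact: (complete_nonzero Ab hy ms Ayy BA An0).
have cb : cond_c -> cond_b.
  move=> [An0 /near1_max ms Ayy].
  have [B BA _] := complete_of_conditions T Ab hy ms Ayy.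
  exists B; split; first exact: (complete_strong Ab hy ms Ayy BA).
  exact: (complete_nonzero Ab hy ms Ayy BA An0).
split; [by split=> [/ac/cb|/bc/ca]|by split|].
move=> [An0 /near1_max ms Ayy]; split.
  by have [B BA _] := complete_of_conditions T Ab hy ms Ayy; exists B.
move=> B B1 B2 BA B1A B2A.
have B1E := factorwise_unique Ab hy ms Ayy BA B1A.
have B2E := strong_unique Ab hy ms Ayy BA B2A.
have [[BW _ _] _] := complete_factorwise Ab hy ms Ayy BA.
split=> //.
- by move=> x Wx; rewrite B1E // B2E.
- by apply: eq_opnorm => x Wx; rewrite B1E // B2E.
rewrite (eq_opnorm B1E) (opnorm_complete Ab hy ms Ayy BA).
exact: (norm_prod_uncond Ab hy ms Ayy).
Qed.
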